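(* There is a polynomial-time algorithm which, given as input a graph $G$ of maximum degree at most $3$, outputs a KT orientation of $G$, or a (correct) determination that none exists.
   Context: All graphs are finite and simple. An orientation $D$ of a graph $G$ is a KT orientation if for all distinct vertices $u,v$ there is at most one directed path (in any direction) between $u$ and $v$ in $D$, i.e. the total number of directed paths from $u$ to $v$ and from $v$ to $u$ is at most one. *)

(* Defs.v *)
From mathcomp Require Import all_boot.

Set Implicit Arguments.
Unset Strict Implicit.
Unset Printing Implicit Defensive.

(** * Polynomial time

    The model of computation is the WHILE language (N. D. Jones,
    "Computability and Complexity from a Programming Perspective", 1997):
    imperative programs whose variables hold binary trees.  Instead of unit
    cost, every expression node is charged the full size of the tree it
    evaluates to, so that sharing of subtrees is never free: a program of
    cost [t] is simulated by a Turing machine in time polynomial in [t] and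
    the input size, and conversely Turing machine steps have cost polynomial
    in the length of the tapes. *)

Inductive tree : Type := Leaf | Node of tree & tree.

Fixpoint tree_size (a : tree) : nat :=
  if a is Node l r then (tree_size l + tree_size r).+1 else 1.

Definition thead (a : tree) : tree := if a is Node l _ then l else Leaf.
Definition ttail (a : tree) : tree := if a is Node _ r then r else Leaf.
Definition is_node (a : tree) : bool := if a is Node _ _ then true else false.

Inductive expr : Type :=
  | EVar of nat
  | ELeaf
  | ENode of expr & expr
  | EHead of expr
  | ETail of expr.

Inductive cmd : Type :=
  | CSkip
  | CAssign of nat & expr
  | CSeq of cmd & cmd
  | CIf of expr & cmd & cmd
  | CWhile of expr & cmd.

Definition store : Type := nat -> tree.

Definition update (s : store) (x : nat) (a : tree) : store :=
  fun y => if y == x then a else s y.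

Fixpoint eval (s : store) (f : expr) : tree :=
  match f with
  | EVar x => s x
  | ELeaf => Leaf
  | ENode f1 f2 => Node (eval s f1) (eval s f2)
  | EHead f1 => thead (eval s f1)
  | ETail f1 => ttail (eval s f1)
  end.

Fixpoint ecost (s : store) (f : expr) : nat :=
  tree_size (eval s f) +
  match f with
  | EVar _ | ELeaf => 0
  | ENode f1 f2 => ecost s f1 + ecost s f2
  | EHead f1 | ETail f1 => ecost s f1
  end.

(** [exec c s t s']: started in [s], the command [c] halts in [s'] with total
    cost [t].  Tests are true on nodes and false on [Leaf]. *)
Inductive exec : cmd -> store -> nat -> store -> Prop :=
  | ExecSkip s : exec CSkip s 1 s
  | ExecAssign s x f :
      exec (CAssign x f) s (ecost s f).+1 (update s x (eval s f))
  | ExecSeq c1 c2 s s1 s2 t1 t2 :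
      exec c1 s t1 s1 -> exec c2 s1 t2 s2 ->
      exec (CSeq c1 c2) s (t1 + t2).+1 s2
  | ExecIfTrue f c1 c2 s s1 t :
      is_node (eval s f) -> exec c1 s t s1 ->
      exec (CIf f c1 c2) s (ecost s f + t).+1 s1
  | ExecIfFalse f c1 c2 s s1 t :
      ~~ is_node (eval s f) -> exec c2 s t s1 ->
      exec (CIf f c1 c2) s (ecost s f + t).+1 s1
  | ExecWhileTrue f c s s1 s2 t1 t2 :
      is_node (eval s f) -> exec c s t1 s1 -> exec (CWhile f c) s1 t2 s2 ->
      exec (CWhile f c) s (ecost s f + t1 + t2).+1 s2
  | ExecWhileFalse f c s :
      ~~ is_node (eval s f) -> exec (CWhile f c) s (ecost s f).+1 s.

(** Variable [0] carries both the input and the output. *)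
Definition init_store (a : tree) : store := fun x => if x == 0 then a else Leaf.

Definition runs (c : cmd) (a : tree) (t : nat) (b : tree) : Prop :=
  exists2 s : store, exec c (init_store a) t s & s 0 = b.

(** * Encodings: (di)graphs are given by their adjacency matrices *)

Definition enc_bool (b : bool) : tree := if b then Node Leaf Leaf else Leaf.

Definition enc_seq (T : Type) (enc : T -> tree) (s : seq T) : tree :=
  foldr (fun x a => Node (enc x) a) Leaf s.

Definition enc_option (T : Type) (enc : T -> tree) (o : option T) : tree :=
  if o is Some x then Node (enc x) Leaf else Leaf.

Definition enc_rel (n : nat) (r : rel 'I_n) : tree :=
  enc_seq (enc_seq enc_bool) [seq [seq r u v | v <- enum 'I_n] | u <- enum 'I_n].

(** * Graphs and KT orientations *)

Definition simple_graph (V : finType) (e : rel V) : Prop :=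
  symmetric e /\ irreflexive e.

Definition max_degree (V : finType) (e : rel V) : nat := \max_(u : V) #|e u|.

Definition orientation (V : finType) (e D : rel V) : Prop :=
  (forall u v, D u v -> e u v) /\ (forall u v, e u v -> D u v (+) D v u).

(** [s] is the full vertex sequence of the path, both ends included. *)
Definition dipath (V : finType) (D : rel V) (u v : V) (s : seq V) : bool :=
  [&& ohead s == Some u, last u s == v, sorted D s & uniq s].

Definition KT_orientation (V : finType) (e D : rel V) : Prop :=
  orientation e D /\
  forall (u v : V) (s1 s2 : seq V), u != v ->
    dipath D u v s1 || dipath D v u s1 ->
    dipath D u v s2 || dipath D v u s2 ->
    s1 = s2.

Definition KT_answer (V : finType) (e : rel V) (o : option (rel V)) : Prop :=
  match o with
  | Some D => KT_orientation e D
  | None => ~ exists D : rel V, KT_orientation e D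
  end.

(* Main.v *)
Require Import Defs.
From mathcomp Require Import all_boot zify.

Set Implicit Arguments.
Unset Strict Implicit.
Unset Printing Implicit Defensive.

(** In a KT orientation every 4-cycle alternates between sources and sinks.  Two
    4-cycles through a vertex of degree at most 3 share an edge at that vertex,
    so the vertex is a source of all of them or a sink of all of them: the edges
    lying on 4-cycles form a bipartite graph.  Conversely, let [G] be
    triangle-free and let those edges be bipartite.  Colour them properly, then
    flip vertices having at least two neighbours of their own colour for as long
    as there are any.  Such vertices lie on no 4-cycle, and each flip decreases
    the number of monochromatic edges, which end up forming a matching.  Orient
    the bichromatic edges from colour [true] to colour [false] and the
    monochromatic ones arbitrarily: directed paths have length at most 3, and two
    of them with the same ends would yield a triangle or a 4-cycle with a
    monochromatic edge.

    The proper colouring is found by merging classes of vertices whose relative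
    colours are forced, one edge at a time. *)

(** * Polynomial-time functions *)

Class encodable (T : Type) := enc : T -> tree.

#[export] Instance encodable_bool : encodable bool := enc_bool.
#[export] Instance encodable_seq T (eT : encodable T) : encodable (seq T) :=
  enc_seq (@enc T eT).
#[export] Instance encodable_option T (eT : encodable T) :
  encodable (option T) := enc_option (@enc T eT).
#[export] Instance encodable_prod A B (eA : encodable A) (eB : encodable B) :
  encodable (A * B) := fun p => Node (enc p.1) (enc p.2).
(* Unary, so that a number can be used as the list driving a loop. *)
#[export] Instance encodable_nat : encodable nat :=
  fun n => enc (nseq n false).

Definition esize T {eT : encodable T} (x : T) : nat := tree_size (enc x).

Lemma leq_exp k m n : m <= n -> m ^ k <= n ^ k.
Proof. by case: k => // k; rewrite leq_exp2r. Qed.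

(** * Polynomially bounded functions of the encoding size *)

Section Bounds.
Context {A : Type} {eA : encodable A}.
Implicit Types g h : A -> nat.

(* The successor makes the base at least 2, so that powers absorb constants
   and sums. *)
Definition pbounded g := exists k, forall a, g a <= (esize a).+1 ^ k.

Lemma pbounded_le g h : (forall a, g a <= h a) -> pbounded h -> pbounded g.
Proof. by move=> le_gh [k hk]; exists k => a; apply: leq_trans (hk a). Qed.

Lemma esize_gt0 (a : A) : 0 < esize a.
Proof. by rewrite /esize; case: (enc a). Qed.

Lemma pbounded_const c : pbounded (fun _ => c).
Proof.
exists c => a; have lt1 : 1 < (esize a).+1 by rewrite ltnS esize_gt0.
exact/ltnW/ltn_expl.
Qed.

Lemma pbounded_esize : pbounded (fun a => esize a).
Proof. by exists 1 => a; rewrite expn1. Qed.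

Lemma pbounded_mul g h :
  pbounded g -> pbounded h -> pbounded (fun a => g a * h a).
Proof. by case=> [i hi] [j hj]; exists (i + j) => a; rewrite expnD leq_mul. Qed.

Lemma pbounded_add g h :
  pbounded g -> pbounded h -> pbounded (fun a => g a + h a).
Proof.
case=> [i hi] [j hj]; exists (i + j).+1 => a.
have Na := esize_gt0 a; rewrite expnS.
apply: (@leq_trans (2 * (esize a).+1 ^ (i + j))); last first.
  by rewrite leq_mul2r ltnS Na orbT.
rewrite mul2n -addnn leq_add //.
  by apply: leq_trans (hi a) _; rewrite leq_exp2l // leq_addr.
by apply: leq_trans (hj a) _; rewrite leq_exp2l // leq_addl.
Qed.

Lemma pbounded_exp g k : pbounded g -> pbounded (fun a => g a ^ k).
Proof. by case=> [i hi]; exists (i * k) => a; rewrite expnM leq_exp. Qed.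

End Bounds.

Lemma pbounded_comp A B {eA : encodable A} {eB : encodable B}
    (f : A -> B) (g : B -> nat) :
  pbounded (fun a => esize (f a)) -> pbounded g -> pbounded (fun a => g (f a)).
Proof.
move=> pf [k hk]; apply: (@pbounded_le _ _ _ (fun a => (esize (f a) + 1) ^ k)).
  by move=> a; rewrite addn1.
exact: pbounded_exp (pbounded_add pf (pbounded_const 1)).
Qed.

Ltac pbounded :=
  repeat first [ exact: pbounded_const | exact: pbounded_esize
               | assumption | apply: pbounded_add | apply: pbounded_mul ].

(** * Polynomial-time computability and its basic closure properties *)

Section Polytime.
Context {A B : Type} {eA : encodable A} {eB : encodable B}.

(* Registers below [m] are preserved, so a caller can keep its data there;
   nothing is assumed about the registers above [m]. *)
Definition computes (f : A -> B) (T : A -> nat) (m : nat) (c : cmd) :=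
  forall s a, s m = enc a ->
  exists t s', [/\ exec c s t s', s' m = enc (f a),
    (forall y, y < m -> s' y = s y) & t <= T a].

(** The output size is bounded separately, so that compositions can be estimated without inspecting
    runs. The time bound is uniform in the base register [m], although the program depends on it. *)
Definition polytime (f : A -> B) :=
  pbounded (fun a => esize (f a)) /\
  exists2 T, pbounded T & forall m, exists c, computes f T m c.

Lemma eq_polytime f g : f =1 g -> polytime f -> polytime g.
Proof.
move=> fg [pf [T pT run]]; split.
  by apply: pbounded_le pf => a; rewrite fg.
exists T => // m; have [c run_c] := run m; exists c => s a /run_c.
by rewrite fg.
Qed.

(** A single assignment suffices. The cost of an expression includes the size of its value, so [T]
    bounds the output as well. *)
Lemma polytime_expr (f : A -> B) (T : A -> nat) : pbounded T ->
  (forall m, exists E, forall s a, s m = enc a ->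
     eval s E = enc (f a) /\ ecost s E <= T a) ->
  polytime f.
Proof.
move=> pT run; split.
  apply: pbounded_le pT => a; have [E run_E] := run 0.
  have [] := run_E (fun=> enc a) a erefl; rewrite /esize => <- le_T.
  by apply: leq_trans le_T; case: (E) => *; rewrite /= leq_addr.
exists (fun a => (T a).+1).
  apply: (@pbounded_le _ _ _ (fun a => T a + 1)); first by move=> a; rewrite addn1.
  by pbounded.
move=> m; have [E run_E] := run m; exists (CAssign m E) => s a sm.
have [evE costE] := run_E s a sm.
exists (ecost s E).+1, (update s m (eval s E)); split=> //.
- exact: ExecAssign.
- by rewrite /update eqxx.
- by move=> y lt_ym; rewrite /update ltn_eqF.
Qed.

End Polytime.
Arguments polytime {A B eA eB}.

Lemma polytime_id A {eA : encodable A} : polytime (fun a : A => a).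
Proof.
apply: (polytime_expr pbounded_esize) => m; exists (EVar m) => s a /= ->.
by rewrite addn0.
Qed.

Lemma polytime_comp A B C {eA : encodable A} {eB : encodable B}
    {eC : encodable C} (f : A -> B) (g : B -> C) :
  polytime f -> polytime g -> polytime (fun a => g (f a)).
Proof.
move=> [pf [Tf pTf runf]] [pg [Tg pTg rung]].
split; first exact: pbounded_comp pf pg.
exists (fun a => Tf a + Tg (f a) + 1).
  by have := pbounded_comp pf pTg => pTgf; pbounded.
move=> m; have [cf run_f] := runf m; have [cg run_g] := rung m.
exists (CSeq cf cg) => s a sm.
have [t1 [s1 [ex1 s1m fr1 le1]]] := run_f s a sm.
have [t2 [s2 [ex2 s2m fr2 le2]]] := run_g s1 (f a) s1m.
exists (t1 + t2).+1, s2; split=> //; first exact: ExecSeq ex1 ex2.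
  by move=> y lt_ym; rewrite fr2 ?fr1.
by rewrite addn1 ltnS leq_add.
Qed.

Lemma polytime_pair A B C {eA : encodable A} {eB : encodable B}
    {eC : encodable C} (f : A -> B) (g : A -> C) :
  polytime f -> polytime g -> polytime (fun a => (f a, g a)).
Proof.
move=> [pf [Tf pTf runf]] [pg [Tg pTg rung]]; split.
  apply: (@pbounded_le _ _ _ (fun a => esize (f a) + esize (g a) + 1)).
    by move=> a; rewrite addn1.
  by pbounded.
exists (fun a => Tf a + Tg a + 2 * esize a + 2 * esize (f a) + 2 * esize (g a) + 10).
  by pbounded.
move=> m; have [cf run_f] := runf m.+1; have [cg run_g] := rung m.+2.
(* [f] works from register [m.+1] and [g] from [m.+2]: the input at [m] survives both runs, and the
   value of [f] survives the second. *)
exists (CSeq (CAssign m.+1 (EVar m)) (CSeq cf (CSeq (CAssign m.+2 (EVar m))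
  (CSeq cg (CAssign m (ENode (EVar m.+1) (EVar m.+2))))))) => s a sm.
pose s0 := update s m.+1 (s m).
have [|t1 [s1 [ex1 s1m fr1 le1]]] := run_f s0 a.
  by rewrite /s0 /update eqxx.
have s1m0 : s1 m = enc a by rewrite fr1 // /s0 /update ltn_eqF.
pose s2 := update s1 m.+2 (s1 m).
have [|t2 [s3 [ex2 s3m fr2 le2]]] := run_g s2 a.
  by rewrite /s2 /update eqxx.
have s3m1 : s3 m.+1 = enc (f a) by rewrite fr2 // /s2 /update ltn_eqF.
exists ((ecost s (EVar m)).+1 + (t1 + ((ecost s1 (EVar m)).+1 + (t2 +
  (ecost s3 (ENode (EVar m.+1) (EVar m.+2))).+1).+1).+1).+1).+1,
  (update s3 m (Node (s3 m.+1) (s3 m.+2))); split.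
- apply: ExecSeq (ExecAssign _ _ _) _; apply: ExecSeq ex1 _.
  apply: ExecSeq (ExecAssign _ _ _) _; apply: ExecSeq ex2 _.
  exact: ExecAssign.
- by rewrite /update eqxx s3m1 s3m.
- move=> y lt_ym; rewrite /update ltn_eqF // fr2 1?ltnW // ?ltnS 1?ltnW //.
  rewrite /s2 /update ltn_eqF ?fr1 ?ltnS 1?ltnW //; last by rewrite ltnW.
  by rewrite /s0 /update ltn_eqF // ltnS ltnW.
- rewrite /= sm s1m0 s3m1 s3m /= !addn0 /esize; lia.
Qed.

Section Conditional.
Context {A B Y : Type} {eA : encodable A} {eB : encodable B} {eY : encodable Y}.

(** Testing the encoding covers booleans and emptiness of lists at once. *)
Lemma polytime_if_node (b : A -> Y) (f g : A -> B) :
  polytime b -> polytime f -> polytime g ->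
  polytime (fun a => if is_node (enc (b a)) then f a else g a).
Proof.
move=> [pb [Tb pTb runb]] [pf [Tf pTf runf]] [pg [Tg pTg rung]]; split.
  apply: (@pbounded_le _ _ _ (fun a => esize (f a) + esize (g a))).
    by move=> a; case: ifP; rewrite ?leq_addr ?leq_addl.
  by pbounded.
exists (fun a => Tb a + Tf a + Tg a + 2 * esize a + 2 * esize (b a) + 20).
  by pbounded.
move=> m; have [cb run_b] := runb m.+1.
have [cf run_f] := runf m; have [cg run_g] := rung m.
exists (CSeq (CAssign m.+1 (EVar m)) (CSeq cb (CIf (EVar m.+1) cf cg))) => s a sm.
pose s0 := update s m.+1 (s m).
have [|t1 [s1 [ex1 s1m fr1 le1]]] := run_b s0 a.
  by rewrite /s0 /update eqxx.
have s1m0 : s1 m = enc a by rewrite fr1 // /s0 /update ltn_eqF.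
have frs y : y < m -> s1 y = s y.
  by move=> lt_ym; rewrite fr1 ?/s0 /update ?ltn_eqF // ltnS ltnW.
case: ifPn => ba.
- have [t2 [s2 [ex2 s2m fr2 le2]]] := run_f s1 a s1m0.
  exists ((ecost s (EVar m)).+1 + (t1 + (ecost s1 (EVar m.+1) + t2).+1).+1).+1, s2.
  split=> //; last by rewrite /= sm s1m /esize /=; lia.
    apply: ExecSeq (ExecAssign _ _ _) _; apply: ExecSeq ex1 _.
    by apply: ExecIfTrue ex2; rewrite /= s1m.
  by move=> y lt_ym; rewrite fr2 ?frs.
- have [t2 [s2 [ex2 s2m fr2 le2]]] := run_g s1 a s1m0.
  exists ((ecost s (EVar m)).+1 + (t1 + (ecost s1 (EVar m.+1) + t2).+1).+1).+1, s2.
  split=> //; last by rewrite /= sm s1m /esize /=; lia.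
    apply: ExecSeq (ExecAssign _ _ _) _; apply: ExecSeq ex1 _.
    by apply: ExecIfFalse ex2; rewrite /= s1m.
  by move=> y lt_ym; rewrite fr2 ?frs.
Qed.

End Conditional.

Lemma polytime_if A B {eA : encodable A} {eB : encodable B}
    (b : A -> bool) (f g : A -> B) :
  polytime b -> polytime f -> polytime g ->
  polytime (fun a => if b a then f a else g a).
Proof.
move=> pb pf pg; apply: eq_polytime (polytime_if_node pb pf pg) => a.
by case: (b a).
Qed.

Lemma esize_pair A B {eA : encodable A} {eB : encodable B} (a : A) (b : B) :
  esize (a, b) = (esize a + esize b).+1.
Proof. by []. Qed.

(** * Encoding sizes of lists *)

Section SeqSize.
Context {X : Type} {eX : encodable X}.
Implicit Types s : seq X.

Lemma esize_cons x s : esize (x :: s) = (esize x + esize s).+1.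
Proof. by []. Qed.

Lemma esize_cat s1 s2 : (esize (s1 ++ s2)).+1 = esize s1 + esize s2.
Proof. by elim: s1 => //= x s1 IHs; rewrite !esize_cons; lia. Qed.

Lemma esize_rev s : esize (rev s) = esize s.
Proof.
elim: s => // x s IHs; apply: succn_inj.
by rewrite rev_cons -cats1 esize_cat IHs !esize_cons -[esize [::]]/1; lia.
Qed.

Lemma size_esize s : size s < esize s.
Proof. by elim: s => //= x s IHs; rewrite esize_cons; lia. Qed.

End SeqSize.

(** * Left folds, the one source of loops *)

Section Fold.
Context {A B X : Type} {eA : encodable A} {eB : encodable B} {eX : encodable X}.

Variables (f : A -> B -> X -> B) (z : A -> B) (l : A -> seq X) (G : A -> nat).

(** [G] bounds every intermediate accumulator: repeating a polynomial-time step could otherwise let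
    sizes grow exponentially. *)
Lemma polytime_foldl :
  polytime (fun p : A * B * X => f p.1.1 p.1.2 p.2) ->
  polytime z -> polytime l -> pbounded G ->
  (forall a s1 s2, l a = s1 ++ s2 -> esize (foldl (f a) (z a) s1) <= G a) ->
  polytime (fun a => foldl (f a) (z a) (l a)).
Proof.
move=> [pf [Tf [kf pTf] runf]] [pz [Tz pTz runz]] [pl [Tl pTl runl]] pG leG.
split; first by apply: pbounded_le pG => a; apply: (leG a _ [::]); rewrite cats0.
pose S a := @esize A eA a + G a + @esize _ (encodable_seq eX) (l a).
(* The cost of one round: the power pays for [f], the 3 being the two pair nodes of its argument and
   the successor in [pTf]; the linear terms pay for copying. *)
pose C (a : A) := (S a + 3) ^ kf + 20 * S a + 20.
have pS : pbounded S by pbounded.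
have pC : pbounded C.
  apply: pbounded_add; last exact: pbounded_const.
  apply: pbounded_add; last by pbounded.
  by apply: pbounded_exp; pbounded.
exists (fun a => Tl a + Tz a + (esize (l a)).+1 * C a + 20 * S a + 20).
  apply: pbounded_add; last by pbounded.
  apply: pbounded_add; last by pbounded.
  apply: pbounded_add; first by pbounded.
  apply: pbounded_mul => //; apply: (@pbounded_le _ _ _ (fun a => esize (l a) + 1)).
    by move=> a; rewrite addn1.
  by pbounded.
move=> m; have [cf run_f] := runf (m + 3).
have [cl run_l] := runl (m + 1); have [cz run_z] := runz (m + 2).
(* Register [m] holds the input, [m + 1] the rest of the list, [m + 2] the accumulator, [m + 3] the
   argument and then the result of [f]. *)
pose arg := ENode (ENode (EVar m) (EVar (m + 2))) (EHead (EVar (m + 1))).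
pose body := CSeq (CAssign (m + 3) arg) (CSeq cf
  (CSeq (CAssign (m + 2) (EVar (m + 3)))
        (CAssign (m + 1) (ETail (EVar (m + 1)))))).
pose loop := CWhile (EVar (m + 1)) body.
(* Loop invariant: [s1] has been consumed and [s2] remains. *)
have run_loop a s2 : forall s1 s, l a = s1 ++ s2 -> s m = enc a ->
    s (m + 1) = enc s2 -> s (m + 2) = enc (foldl (f a) (z a) s1) ->
  exists t s', [/\ exec loop s t s', s' (m + 2) = enc (foldl (f a) (z a) (l a)),
    (forall y, y < m -> s' y = s y) & t <= (size s2).+1 * C a].
  elim: s2 => [|x s2 IHs] s1 s la sm sm1 sm2.
    exists (ecost s (EVar (m + 1))).+1, s; split=> //.
    + by apply: ExecWhileFalse; rewrite /= sm1.
    + by rewrite sm2 la cats0.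
    + by rewrite /= sm1 /= /C; lia.
  pose b := foldl (f a) (z a) s1.
  have leb : esize b <= G a := leG _ _ _ la.
  have lel : esize (x :: s2) <= esize (l a).
    by rewrite la; have := @esize_cat _ eX s1 (x :: s2); have := @size_esize _ eX s1; lia.
  have leb' : esize (f a b x) <= G a.
    have -> : f a b x = foldl (f a) (z a) (rcons s1 x).
      by rewrite -cats1 foldl_cat.
    by apply: (leG _ _ s2); rewrite cat_rcons.
  pose s3 := update s (m + 3) (eval s arg).
  have [|t1 [s4 [ex1 s4m fr1 le1]]] := run_f s3 ((a, b), x).
    by rewrite /s3 /update eqxx /= sm sm1 sm2.
  have frs y : y < m + 3 -> s4 y = s y.
    by move=> lt_y; rewrite fr1 // /s3 /update ltn_eqF.
  pose s5 := update s4 (m + 2) (s4 (m + 3)).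
  pose s6 := update s5 (m + 1) (ttail (s5 (m + 1))).
  have s5m1 : s5 (m + 1) = Node (enc x) (enc s2).
    by rewrite /s5 /update (_ : (m + 1 == m + 2) = false) ?frs ?sm1 //; lia.
  have fr6 y : y < m + 1 -> s6 y = s y.
    move=> lt_y; rewrite /s6 /s5 /update.
    rewrite (_ : (y == m + 1) = false); last lia.
    rewrite (_ : (y == m + 2) = false); last lia.
    by rewrite frs //; lia.
  have [||||t2 [s7 [ex2 s7m fr2 le2]]] := IHs (rcons s1 x) s6.
  + by rewrite cat_rcons.
  + by rewrite fr6 //; lia.
  + by rewrite /s6 /update eqxx s5m1.
  + rewrite /s6 /s5 /update (_ : (m + 2 == m + 1) = false); last lia.
    by rewrite eqxx s4m -cats1 foldl_cat.
  exists (ecost s (EVar (m + 1)) + ((ecost s arg).+1 + (t1 +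
    ((ecost s4 (EVar (m + 3))).+1 +
     (ecost s5 (ETail (EVar (m + 1)))).+1).+1).+1).+1 + t2).+1, s7.
  split=> //.
  + apply: ExecWhileTrue ex2; first by rewrite /= sm1.
    apply: ExecSeq (ExecAssign _ _ _) _; apply: ExecSeq ex1 _.
    by apply: ExecSeq (ExecAssign _ _ _) _; apply: ExecAssign.
  + by move=> y lt_y; rewrite fr2 // fr6 //; lia.
  have let1 : t1 <= (S a + 3) ^ kf.
    apply: leq_trans le1 _; apply: leq_trans (pTf _) _; apply: leq_exp => //.
    rewrite !esize_pair /S; move: lel; rewrite esize_cons; lia.
  rewrite [_ * C a]mulSn -addSn leq_add //.
  rewrite /= sm sm1 sm2 s5m1 s4m /= !addn0 -/(enc s2) /C.
  have := erefl (S a); rewrite {2}/S; move: leb lel leb' let1.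
  rewrite /b esize_cons /esize; lia.
exists (CSeq (CAssign (m + 1) (EVar m)) (CSeq cl
  (CSeq (CAssign (m + 2) (EVar m)) (CSeq cz
  (CSeq loop (CAssign m (EVar (m + 2)))))))) => s a sm.
pose s0 := update s (m + 1) (s m).
have [|t1 [s1 [ex1 s1m fr1 le1]]] := run_l s0 a.
  by rewrite /s0 /update eqxx.
have frs1 y : y < m + 1 -> s1 y = s y.
  by move=> lt_y; rewrite fr1 // /s0 /update ltn_eqF.
have s1m0 : s1 m = enc a by rewrite frs1 //; lia.
pose s2 := update s1 (m + 2) (s1 m).
have [|t2 [s3 [ex2 s3m fr2 le2]]] := run_z s2 a.
  by rewrite /s2 /update eqxx.
have frs3 y : y < m + 2 -> s3 y = s1 y.
  by move=> lt_y; rewrite fr2 // /s2 /update ltn_eqF.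
have [||||t3 [s4 [ex3 s4m fr3 le3]]] := run_loop a (l a) [::] s3 => //.
- by rewrite frs3 //; lia.
- by rewrite frs3 //; lia.
exists ((ecost s (EVar m)).+1 + (t1 + ((ecost s1 (EVar m)).+1 + (t2 + (t3 +
  (ecost s4 (EVar (m + 2))).+1).+1).+1).+1).+1).+1, (update s4 m (s4 (m + 2))).
split.
- apply: ExecSeq (ExecAssign _ _ _) _; apply: ExecSeq ex1 _.
  apply: ExecSeq (ExecAssign _ _ _) _; apply: ExecSeq ex2 _.
  by apply: ExecSeq ex3 _; apply: ExecAssign.
- by rewrite /update eqxx.
- by move=> y lt_y; rewrite /update ltn_eqF // fr3 // frs3 ?frs1 //; lia.
have leG' : esize (foldl (f a) (z a) (l a)) <= G a.
  by apply: (leG _ _ [::]); rewrite cats0.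
have lel : (size (l a)).+1 * C a <= (esize (l a)).+1 * C a.
  by rewrite leq_mul2r ltnS ltnW ?orbT // size_esize.
rewrite /= sm s1m0 s4m !addn0 /S; move: leG' lel le1 le2 le3; rewrite /esize; lia.
Qed.

End Fold.

(** * Constants, pairs, options and booleans *)

Fixpoint quote (a : tree) : expr :=
  if a is Node l r then ENode (quote l) (quote r) else ELeaf.

Lemma eval_quote s a : eval s (quote a) = a.
Proof. by elim: a => //= l -> r ->. Qed.

Lemma ecost_quote s s' a : ecost s (quote a) = ecost s' (quote a).
Proof. by elim: a => //= l -> r ->; rewrite !eval_quote. Qed.

Section Basic.
Context {A : Type} {eA : encodable A}.

Lemma polytime_const B {eB : encodable B} (b : B) : polytime (fun _ : A => b).
Proof.
apply: (polytime_expr (pbounded_const (ecost (fun=> Leaf) (quote (enc b))))).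
(* The language has no tree literals, so the constant is built node by node. *)
move=> m; exists (quote (enc b)) => s a _; rewrite eval_quote; split=> //.
by rewrite (ecost_quote s (fun=> Leaf)).
Qed.

Lemma polytime_fst B C {eB : encodable B} {eC : encodable C} (f : A -> B * C) :
  polytime f -> polytime (fun a => (f a).1).
Proof.
move=> pf; apply: (polytime_comp pf).
apply: (@polytime_expr _ _ _ _ _ (fun p => 2 * esize p)); first by pbounded.
move=> m; exists (EHead (EVar m)) => s [b c] /= ->; split=> //.
by rewrite esize_pair /esize /=; lia.
Qed.

Lemma polytime_snd B C {eB : encodable B} {eC : encodable C} (f : A -> B * C) :
  polytime f -> polytime (fun a => (f a).2).
Proof.
move=> pf; apply: (polytime_comp pf).
apply: (@polytime_expr _ _ _ _ _ (fun p => 2 * esize p)); first by pbounded.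
move=> m; exists (ETail (EVar m)) => s [b c] /= ->; split=> //.
by rewrite esize_pair /esize /=; lia.
Qed.

Lemma polytime_Some B {eB : encodable B} (f : A -> B) :
  polytime f -> polytime (fun a => Some (f a)).
Proof.
move=> pf; apply: (polytime_comp pf).
apply: (@polytime_expr _ _ _ _ _ (fun b => 2 * esize b + 3)); first by pbounded.
move=> m; exists (ENode (EVar m) ELeaf) => s b /= ->; split=> //.
by rewrite /esize /=; lia.
Qed.

Lemma polytime_andb (b1 b2 : A -> bool) :
  polytime b1 -> polytime b2 -> polytime (fun a => b1 a && b2 a).
Proof. by move=> p1 p2; apply: polytime_if => //; apply: polytime_const. Qed.

Lemma polytime_orb (b1 b2 : A -> bool) :
  polytime b1 -> polytime b2 -> polytime (fun a => b1 a || b2 a).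
Proof. by move=> p1 p2; apply: polytime_if => //; apply: polytime_const. Qed.

Lemma polytime_negb (b : A -> bool) : polytime b -> polytime (fun a => ~~ b a).
Proof. by move=> pb; apply: polytime_if => //; apply: polytime_const. Qed.

Lemma polytime_addb (b1 b2 : A -> bool) :
  polytime b1 -> polytime b2 -> polytime (fun a => b1 a (+) b2 a).
Proof.
move=> p1 p2; apply: (@eq_polytime _ _ _ _ (fun a => if b1 a then ~~ b2 a else b2 a)).
  by move=> a; case: (b1 a).
by apply: polytime_if => //; apply: polytime_negb.
Qed.

Lemma polytime_eqb (b1 b2 : A -> bool) :
  polytime b1 -> polytime b2 -> polytime (fun a => b1 a == b2 a).
Proof.
move=> p1 p2; apply: (@eq_polytime _ _ _ _ (fun a => ~~ (b1 a (+) b2 a))).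
  by move=> a; case: (b1 a); case: (b2 a).
exact/polytime_negb/polytime_addb.
Qed.

End Basic.

(** * Elementary list operations *)

Section Lists.
Context {A X : Type} {eA : encodable A} {eX : encodable X}.

(** A pair and a nonempty list are encoded by the same node, so the encoded pair already is the
    encoded list. *)
Lemma polytime_cons (x : A -> X) (s : A -> seq X) :
  polytime x -> polytime s -> polytime (fun a => x a :: s a).
Proof.
move=> px ps; apply: (polytime_comp (polytime_pair px ps) (g := fun p => p.1 :: p.2)).
apply: (polytime_expr pbounded_esize) => m; exists (EVar m) => t p /= ->.
by rewrite addn0.
Qed.

Lemma polytime_behead (s : A -> seq X) :
  polytime s -> polytime (fun a => behead (s a)).
Proof.
move=> ps; apply: (polytime_comp ps).
apply: (@polytime_expr _ _ _ _ _ (fun s => 2 * esize s)); first by pbounded.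
move=> m; exists (ETail (EVar m)) => t [|x s'] /= ->; split=> //.
by rewrite /esize /=; lia.
Qed.

(* The head and the tail of [Leaf] are [Leaf], so this is the only default
   value that comes for free. *)
Lemma polytime_head (x0 : X) (s : A -> seq X) : enc x0 = Leaf ->
  polytime s -> polytime (fun a => head x0 (s a)).
Proof.
move=> x0E ps; apply: (polytime_comp ps).
apply: (@polytime_expr _ _ _ _ _ (fun s => 2 * esize s)); first by pbounded.
move=> m; exists (EHead (EVar m)) => t [|x s'] /= ->; split=> //.
rewrite addn0 mul2n -addnn leq_add2r -[Defs.thead _]/(enc x) esize_cons;
exact: leqW (leq_addr _ _).
Qed.

Lemma polytime_nilp (s : A -> seq X) :
  polytime s -> polytime (fun a => nilp (s a)).
Proof.
move=> ps.
refine (eq_polytime _ (polytime_if_node ps (polytime_const false) (polytime_const true))).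
by move=> a; case: (s a).
Qed.

End Lists.

Lemma esize_nat n : esize n = (2 * n).+1.
Proof.
elim: n => // n IHn; have -> : esize n.+1 = (esize n).+2 by [].
by rewrite IHn; lia.
Qed.

Lemma esize_bool (b : bool) : esize b <= 3.
Proof. by case: b. Qed.

Lemma esize_all X {eX : encodable X} b (s : seq X) :
  all (fun x => esize x <= b) s -> esize s <= (size s * b.+1).+1.
Proof.
elim: s => //= x s IHs /andP[xb /IHs sb].
by rewrite esize_cons; lia.
Qed.

Lemma all_esize X {eX : encodable X} (s : seq X) :
  all (fun x => esize x <= esize s) s.
Proof.
elim: s => //= x s IHs; rewrite esize_cons leqW ?leq_addr //=.
by apply: sub_all IHs => y le_y; rewrite leqW // (leq_trans le_y) ?leq_addl.
Qed.

(* Up to [enc], a number is the list of its units. *)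
Lemma polytime_nseq A {eA : encodable A} (n : A -> nat) :
  polytime n -> polytime (fun a => nseq (n a) false).
Proof.
move=> pn; apply: (polytime_comp pn (g := fun n => nseq n false)).
apply: (polytime_expr pbounded_esize) => m; exists (EVar m) => t i /= ->.
by rewrite addn0.
Qed.

(** * Reversal, right folds and bounded iteration *)

Section Recursion.
Context {A B X : Type} {eA : encodable A} {eB : encodable B} {eX : encodable X}.

Lemma polytime_rev (l : A -> seq X) :
  polytime l -> polytime (fun a => rev (l a)).
Proof.
move=> pl.
have pf : polytime (fun p : A * seq X * X => p.2 :: p.1.2).
  apply: polytime_cons; first exact/polytime_snd/polytime_id.
  exact/polytime_snd/polytime_fst/polytime_id.
have revE (s : seq X) : foldl (fun s x => x :: s) [::] s = rev s.
  by rewrite /rev; elim: s [::] => //= x s IHs s'; apply: IHs.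
refine (eq_polytime _ (polytime_foldl (f := fun _ s x => x :: s) pf
  (polytime_const [::]) pl (G := fun a => esize (l a)) pl.1 _)).
  by move=> a; apply: revE.
move=> a s1 s2 ->; rewrite revE esize_rev.
by have := @esize_cat _ eX s1 s2; have := @size_esize _ eX s2; lia.
Qed.

(** This is a left fold over the reversed list. Its intermediate values are right folds over
    suffixes, whence the form of the size condition. *)
Lemma polytime_foldr (f : A -> X -> B -> B) (z : A -> B) (l : A -> seq X)
    (G : A -> nat) :
  polytime (fun p : A * X * B => f p.1.1 p.1.2 p.2) ->
  polytime z -> polytime l -> pbounded G ->
  (forall a s1 s2, l a = s1 ++ s2 -> esize (foldr (f a) (z a) s2) <= G a) ->
  polytime (fun a => foldr (f a) (z a) (l a)).
Proof.
move=> pf pz pl pG leG.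
have pf' : polytime (fun p : A * B * X => f p.1.1 p.2 p.1.2).
  apply: (polytime_comp (f := fun p : A * B * X => (p.1.1, p.2, p.1.2)) _ pf).
  apply: polytime_pair; last exact/polytime_snd/polytime_fst/polytime_id.
  apply: polytime_pair; last exact/polytime_snd/polytime_id.
  exact/polytime_fst/polytime_fst/polytime_id.
refine (eq_polytime _ (polytime_foldl (f := fun a b x => f a x b) pf' pz
  (polytime_rev pl) pG _)); first by move=> a; rewrite foldl_rev.
move=> a s1 s2 /(congr1 rev); rewrite revK rev_cat => /leG.
by rewrite -[s1 in foldl _ _ s1]revK foldl_rev.
Qed.

End Recursion.

(** The unary number serves as the list of a fold that ignores its items. *)
Lemma polytime_iter A B {eA : encodable A} {eB : encodable B}
    (f : A -> B -> B) (n : A -> nat)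
    (z : A -> B) (G : A -> nat) :
  polytime (fun p : A * B => f p.1 p.2) ->
  polytime n -> polytime z -> pbounded G ->
  (forall a i, i <= n a -> esize (iter i (f a) (z a)) <= G a) ->
  polytime (fun a => iter (n a) (f a) (z a)).
Proof.
move=> pf pn pz pG leG.
have foldrE a (s : seq bool) :
    foldr (fun _ => f a) (z a) s = iter (size s) (f a) (z a).
  by elim: s => //= _ s ->.
have pf' : polytime (fun p : A * bool * B => f p.1.1 p.2).
  apply: (polytime_comp (f := fun p : A * bool * B => (p.1.1, p.2)) _ pf).
  apply: polytime_pair; last exact/polytime_snd/polytime_id.
  exact/polytime_fst/polytime_fst/polytime_id.
refine (eq_polytime _ (polytime_foldr (f := fun a _ => f a) (G := G) _ pz
  (polytime_nseq pn) pG _)).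
- by move=> a; rewrite foldrE size_nseq.
- exact: pf'.
move=> a s1 s2 /(congr1 size); rewrite size_nseq size_cat foldrE => nE.
by apply: leG; rewrite nE leq_addl.
Qed.

Lemma polytime_succn A {eA : encodable A} (n : A -> nat) :
  polytime n -> polytime (fun a => (n a).+1).
Proof.
move=> pn; apply: (polytime_comp pn).
apply: (@polytime_expr _ _ _ _ _ (fun i => 2 * esize i + 3)); first by pbounded.
move=> r; exists (ENode ELeaf (EVar r)) => s i /= ->; split=> //.
by rewrite /esize /=; lia.
Qed.

Lemma polytime_predn A {eA : encodable A} (n : A -> nat) :
  polytime n -> polytime (fun a => (n a).-1).
Proof.
move=> pn; apply: (polytime_comp pn).
apply: (@polytime_expr _ _ _ _ _ (fun i => 2 * esize i)); first by pbounded.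
move=> r; exists (ETail (EVar r)) => s [|i] /= ->; split=> //.
by rewrite /esize /=; lia.
Qed.

(** * Arithmetic on unary numbers *)

Section Numbers.
Context {A : Type} {eA : encodable A}.
Implicit Types m n : A -> nat.

Lemma polytime_subn m n :
  polytime m -> polytime n -> polytime (fun a => m a - n a).
Proof.
move=> pm pn; have iter_predn i j : iter i predn j = j - i.
  by elim: i => [|i /= ->]; rewrite ?subn0 ?subnS.
refine (eq_polytime _ (polytime_iter (f := fun _ => predn) _ pn pm pm.1 _)).
- by move=> a; apply: iter_predn.
- exact: (polytime_predn (polytime_snd polytime_id)).
- by move=> a i _; rewrite iter_predn !esize_nat ltnS leq_mul2l leq_subr.
Qed.

Lemma polytime_leq m n :
  polytime m -> polytime n -> polytime (fun a => m a <= n a).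
Proof.
move=> pm pn; have pmn := polytime_nilp (polytime_nseq (polytime_subn pm pn)).
by apply: eq_polytime pmn => a; rewrite /nilp size_nseq.
Qed.

Lemma polytime_eqn m n :
  polytime m -> polytime n -> polytime (fun a => m a == n a).
Proof.
move=> pm pn; have := polytime_andb (polytime_leq pm pn) (polytime_leq pn pm).
by apply: eq_polytime => a; rewrite eqn_leq.
Qed.

End Numbers.

(** * Indexing, searching, mapping and concatenation *)

Section ListFunctions.
Context {A X : Type} {eA : encodable A} {eX : encodable X}.
Implicit Types (l : A -> seq X) (P : A -> X -> bool).

Lemma polytime_size l : polytime l -> polytime (fun a => size (l a)).
Proof.
move=> pl; have sizeE (s : seq X) : foldr (fun _ => succn) 0 s = size s.
  by elim: s => //= _ s ->.
refine (eq_polytime _ (polytime_foldr (f := fun _ _ => succn)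
  (G := fun a => 2 * esize (l a)) _ (polytime_const 0) pl _ _)).
- by move=> a; apply: sizeE.
- exact: (polytime_succn (polytime_snd polytime_id)).
- by have pe := pl.1; pbounded.
move=> a s1 s2 la; rewrite sizeE esize_nat.
by have := @size_esize _ eX (l a); rewrite la size_cat; lia.
Qed.

Lemma polytime_nth (x0 : X) l (i : A -> nat) : enc x0 = Leaf ->
  polytime l -> polytime i -> polytime (fun a => nth x0 (l a) (i a)).
Proof.
move=> x0E pl pi.
have dropE j (s : seq X) : iter j behead s = drop j s.
  by elim: j => [|j /= ->]; rewrite ?drop0 // -drop1 drop_drop.
have pd : polytime (fun a => iter (i a) behead (l a)).
  apply: (polytime_iter (f := fun _ => behead) _ pi pl pl.1).
    exact: (polytime_behead (polytime_snd polytime_id)).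
  move=> a j _; rewrite dropE -{2}(cat_take_drop j (l a)).
  have := @esize_cat _ eX (take j (l a)) (drop j (l a)).
  by have := @size_esize _ eX (take j (l a)); lia.
apply: eq_polytime (polytime_head x0E pd) => a.
by rewrite dropE -nth0 nth_drop addn0.
Qed.

Lemma polytime_has P l : polytime (fun p : A * X => P p.1 p.2) ->
  polytime l -> polytime (fun a => has (P a) (l a)).
Proof.
move=> pP pl.
have pf : polytime (fun p : A * X * bool => P p.1.1 p.1.2 || p.2).
  apply: polytime_orb; last exact/polytime_snd/polytime_id.
  exact: polytime_comp (polytime_fst polytime_id) pP.
refine (eq_polytime _ (polytime_foldr (f := fun a x b => P a x || b) pf
  (polytime_const false) pl (pbounded_const 3) _)).
  by move=> a; elim: (l a) => //= x s ->.
by move=> *; apply: esize_bool.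
Qed.

Lemma polytime_find P l : polytime (fun p : A * X => P p.1 p.2) ->
  polytime l -> polytime (fun a => find (P a) (l a)).
Proof.
move=> pP pl.
have pf : polytime (fun p : A * X * nat => if P p.1.1 p.1.2 then 0 else p.2.+1).
  apply: polytime_if.
  - exact: polytime_comp (polytime_fst polytime_id) pP.
  - exact: polytime_const.
  - exact: (polytime_succn (polytime_snd polytime_id)).
have findE a s : foldr (fun x i => if P a x then 0 else i.+1) 0 s = find (P a) s.
  by elim: s => //= x s ->.
refine (eq_polytime _ (polytime_foldr
  (f := fun a x i => if P a x then 0 else i.+1) pf
  (polytime_const 0) pl (G := fun a => 2 * esize (l a)) _ _)).
- by move=> a; apply: findE.
- by have pe := pl.1; pbounded.
move=> a s1 s2 la; rewrite findE esize_nat.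
have := find_size (P a) s2.
by have := @size_esize _ eX (l a); rewrite la size_cat; lia.
Qed.

Lemma polytime_map Y {eY : encodable Y} (f : A -> X -> Y) l :
  polytime (fun p : A * X => f p.1 p.2) ->
  polytime l -> polytime (fun a => map (f a) (l a)).
Proof.
move=> pf pl; have [[k hk] _] := pf.
have pf' : polytime (fun p : A * X * seq Y => f p.1.1 p.1.2 :: p.2).
  apply: polytime_cons; last exact/polytime_snd/polytime_id.
  exact: polytime_comp (polytime_fst polytime_id) pf.
(* No item of [l a] is larger than [l a] itself, so [b a] bounds the size of every item of the
   result. *)
pose b a := (@esize _ eA a + @esize _ (encodable_seq eX) (l a) + 2) ^ k.
refine (eq_polytime _ (polytime_foldr (f := fun a x s => f a x :: s) pf'
  (polytime_const [::]) pl (G := fun a => esize (l a) * (b a + 1) + 1) _ _)).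
- by move=> a; elim: (l a) => //= x s ->.
- have pb : pbounded b by apply: pbounded_exp; have pe := pl.1; pbounded.
  by have pe := pl.1; pbounded.
move=> a s1 s2 la.
have -> : foldr (fun x s => f a x :: s) [::] s2 = map (f a) s2.
  by elim: (s2) => //= x s ->.
apply: leq_trans (esize_all (b := b a) _) _.
  have : all (fun x => esize x <= esize (l a)) (s1 ++ s2) by rewrite -la all_esize.
  rewrite all_cat all_map => /andP[_].
  apply: sub_all => x le_x; apply: leq_trans (hk (a, x)) _; apply: leq_exp.
  by rewrite esize_pair; move: le_x => /=; lia.
rewrite size_map addn1 ltnS addn1 leq_mul2r /=.
by have := @size_esize _ eX (l a); rewrite la size_cat; lia.
Qed.

Lemma polytime_cat l1 l2 :
  polytime l1 -> polytime l2 -> polytime (fun a => l1 a ++ l2 a).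
Proof.
move=> p1 p2.
have pf : polytime (fun p : A * X * seq X => p.1.2 :: p.2).
  apply: polytime_cons; first exact/polytime_snd/polytime_fst/polytime_id.
  exact/polytime_snd/polytime_id.
have catE (s1 s2 : seq X) : foldr cons s2 s1 = s1 ++ s2.
  by elim: s1 => //= x s1 ->.
refine (eq_polytime _ (polytime_foldr (f := fun _ => cons) pf p2 p1
  (G := fun a => esize (l1 a) + esize (l2 a)) _ _)).
- by move=> a; apply: catE.
- by have b1 := p1.1; have b2 := p2.1; pbounded.
move=> a s1 s2 ->; rewrite catE.
have := @esize_cat _ eX s1 s2; have := @esize_cat _ eX s2 (l2 a).
by have := @size_esize _ eX s1; lia.
Qed.

End ListFunctions.

Lemma polytime_flatten A X {eA : encodable A} {eX : encodable X}
    (l : A -> seq (seq X)) :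
  polytime l -> polytime (fun a => flatten (l a)).
Proof.
move=> pl.
refine (polytime_foldr (f := fun _ => cat) (G := fun a => esize (l a))
  _ (polytime_const [::]) pl pl.1 _).
  apply: polytime_cat; first exact/polytime_snd/polytime_fst/polytime_id.
  exact/polytime_snd/polytime_id.
have esize_flatten (s : seq (seq X)) : esize (flatten s) <= esize s.
  elim: s => //= x s IHs; rewrite esize_cons.
  by have := @esize_cat _ eX x (flatten s); lia.
move=> a s1 s2 ->; apply: leq_trans (esize_flatten _) _.
have := @esize_cat _ (encodable_seq eX) s1 s2.
by have := @size_esize _ (encodable_seq eX) s1; lia.
Qed.

(** Counting down from [n] while consing the counter builds the list from its end, by iteration on a
    pair. *)
Lemma polytime_iota A {eA : encodable A} (n : A -> nat) :
  polytime n -> polytime (fun a => iota 0 (n a)).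
Proof.
move=> pn.
have iterE m i : i <= m ->
    iter i (fun p => (p.1.-1, p.1.-1 :: p.2)) (m, [::]) = (m - i, iota (m - i) i).
  elim: i => [|i IHi] lt_im; first by rewrite subn0.
  by rewrite iterS IHi 1?ltnW //= -subnS subnSK.
have pz : polytime (fun a => (n a, [::] : seq nat)).
  by apply: polytime_pair => //; apply: polytime_const.
have pf : polytime (fun p : A * (nat * seq nat) => (p.2.1.-1, p.2.1.-1 :: p.2.2)).
  have pm : polytime (fun p : A * (nat * seq nat) => p.2.1.-1).
    exact/polytime_predn/polytime_fst/polytime_snd/polytime_id.
  apply: polytime_pair => //; apply: polytime_cons => //.
  exact/polytime_snd/polytime_snd/polytime_id.
pose G a := let b := @esize _ encodable_nat (n a) in b + (b * (b + 1) + 2).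
have pi := polytime_snd (polytime_iter (f := fun _ p => (p.1.-1, p.1.-1 :: p.2))
  (G := G) pf pn pz _ _).
apply: eq_polytime (pi _ _) => [a||]; first by rewrite iterE ?subnn.
  by rewrite /G; have pb := pn.1; pbounded.
move=> a i le_i; rewrite iterE // esize_pair /G.
have lt_b : forall j, j <= n a -> esize j <= esize (n a).
  by move=> j; rewrite !esize_nat ltnS leq_mul2l.
rewrite -addnS leq_add ?lt_b ?leq_subr //.
apply: (@leq_trans (i * (esize (n a)).+1).+2).
  rewrite ltnS -[i in i * _](size_iota (n a - i) i); apply: esize_all.
  by apply/allP => j; rewrite mem_iota subnK // => /andP[_ /ltnW]; apply: lt_b.
by rewrite addn1 addn2 !ltnS leq_mul2r esize_nat; lia.
Qed.

(** * KT orientations of subcubic graphs *)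

Section Squares.
Variables (V : finType) (e : rel V).

Definition triangle := [exists u, exists v, exists w, [&& e u v, e v w & e w u]].

(** The edge [u v] of a 4-cycle [u v w x]. Only opposite corners are required to differ, since
    adjacent ones do so once [e] is irreflexive. *)
Definition square_edge u v :=
  e u v && [exists w, exists x, [&& w != u, x != v, e v w, e w x & e x u]].

Definition square_proper (c : V -> bool) :=
  forall u v, square_edge u v -> c u != c v.

Definition unhappy (c : V -> bool) v :=
  [exists w1, exists w2, [&& w1 != w2, e v w1, e v w2, c v == c w1 & c v == c w2]].

(** The ranking [r] settles the arbitrary choices on monochromatic edges, and doubles as a potential
    for acyclicity. *)
Definition orient (c : V -> bool) (r : V -> nat) u v :=
  e u v && (if c u == c v then r u < r v else c u).

Hypotheses (sym_e : symmetric e) (irr_e : irreflexive e).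

Lemma edge_neq u v : e u v -> u != v.
Proof. by apply: contraTneq => ->; rewrite irr_e. Qed.

Lemma triangle_free u v w : ~~ triangle -> e u v -> e v w -> ~~ e w u.
Proof.
move=> tf uv vw; apply: contra tf => wu.
apply/existsP; exists u; apply/existsP; exists v; apply/existsP; exists w.
by rewrite uv vw.
Qed.

Lemma square_edgeI u v w x : e u v -> e v w -> e w x -> e x u ->
  w != u -> x != v -> square_edge u v.
Proof.
move=> uv vw wx xu wu xv; rewrite /square_edge uv.
by apply/existsP; exists w; apply/existsP; exists x; rewrite wu xv vw wx xu.
Qed.

Lemma square_edgeP u v : reflect
  (exists w x, [/\ w != u, x != v, e u v & [/\ e v w, e w x & e x u]])
  (square_edge u v).
Proof.
apply: (iffP andP) => [[uv /existsP[w /existsP[x /and5P[*]]]] | ].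
  by exists w, x.
case=> w [x [wu xv uv [vw wx xu]]]; split=> //.
by apply/existsP; exists w; apply/existsP; exists x; apply/and5P.
Qed.

Lemma square_edge_sym : symmetric square_edge.
Proof.
suff H u v : square_edge u v -> square_edge v u.
  by move=> u v; apply/idP/idP; apply: H.
case/square_edgeP => w [x [wu xv uv [vw wx xu]]].
by apply: (@square_edgeI v u x w); rewrite // sym_e.
Qed.

Lemma max_degree3_neighbours v (s : seq V) :
  max_degree e <= 3 -> uniq s -> all (e v) s -> size s <= 3.
Proof.
move=> deg us es; apply: leq_trans deg; rewrite -(card_uniqP us).
apply: leq_trans (leq_bigmax v); apply/subset_leq_card/subsetP => w.
by move/(allP es).
Qed.

(** * Necessity: consequences of having a KT orientation *)

Section Necessity.
Variable D : rel V.
Hypothesis KT_D : KT_orientation e D.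

Lemma KT_edge u v : D u v -> e u v.
Proof. by case: KT_D => -[+ _] _; apply. Qed.

Lemma KT_flip u v : e u v -> D v u = ~~ D u v.
Proof. by case: KT_D => -[_ +] _ => /[apply]; case: (D u v); case: (D v u). Qed.

Lemma KT_path_eq u v s1 s2 : u != v ->
  dipath D u v s1 || dipath D v u s1 -> dipath D u v s2 || dipath D v u s2 ->
  s1 = s2.
Proof. by case: KT_D => _; apply. Qed.

Lemma KT_unique_path u p q : path D u p -> path D u q ->
  uniq (u :: p) -> uniq (u :: q) -> last u p = last u q -> u != last u p -> p = q.
Proof.
move=> Dp Dq up uq lpq nu.
suff [] : u :: p = u :: q by [].
by apply: (KT_path_eq nu); apply/orP; left; apply/and4P; rewrite /= -?lpq !eqxx.
Qed.

(** The path and the arc back would be two directed paths between the same vertices, in opposite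
    directions. *)
Lemma KT_acyclic u p : path D u p -> uniq (u :: p) -> D (last u p) u -> False.
Proof.
move=> Dp up Dl; have nu : last u p != u by apply/edge_neq/KT_edge.
case: p => [|v p] in Dp up Dl nu *; first by rewrite eqxx in nu.
set w := last _ _ in Dl nu.
suff [uw _] : u :: v :: p = [:: w; u] by rewrite uw eqxx in nu.
apply: (@KT_path_eq u w); first by rewrite eq_sym.
  by apply/orP; left; apply/and4P.
by apply/orP; right; apply/and4P; rewrite /= !eqxx inE Dl nu.
Qed.

(** An oriented triangle is a directed cycle or has a two-arc path parallel to its third arc. *)
Lemma KT_triangle_free : ~~ triangle.
Proof.
apply/negP => /existsP[u /existsP[v /existsP[w /and3P[uv vw wu]]]].
wlog D_uv : u v uv vw wu / D u v.
  move=> H; case D_uv: (D u v); first exact: H D_uv.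
  by apply: (H v u); rewrite 1?sym_e // KT_flip ?D_uv.
have nuv := edge_neq uv; have nvw := edge_neq vw; have nwu := edge_neq wu.
have nuw : u != w by rewrite eq_sym.
case D_vw: (D v w); case D_wu: (D w u).
- by apply: (@KT_acyclic u [:: v; w]);
    rewrite /= ?inE ?negb_or ?D_uv ?D_vw ?D_wu ?nuv ?nuw ?nvw.
- have D_uw : D u w by rewrite KT_flip ?D_wu.
  by have := @KT_unique_path u [:: v; w] [:: w];
    rewrite /= D_uv D_vw D_uw !inE !negb_or nuv nuw nvw => /(_ isT isT isT isT erefl isT).
- have D_wv : D w v by rewrite KT_flip ?D_vw.
  by have := @KT_unique_path w [:: u; v] [:: v];
    rewrite /= D_uv D_wv D_wu !inE !negb_or nuv nwu (eq_sym w) nvw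
    => /(_ isT isT isT isT erefl isT).
- have D_wv : D w v by rewrite KT_flip ?D_vw.
  have D_uw : D u w by rewrite KT_flip ?D_wu.
  by have := @KT_unique_path u [:: w; v] [:: v];
    rewrite /= D_uv D_wv D_uw !inE !negb_or nuv nuw (eq_sym w) nvw
    => /(_ isT isT isT isT erefl isT).
Qed.

(** If [u], [v], [w] were a directed path, the four orientations of the other two edges would yield
    a directed cycle, a three-arc path parallel to an arc (twice), or two parallel two-arc paths. *)
Lemma KT_square_alternates u v w x : e u v -> e v w -> e w x -> e x u ->
  w != u -> x != v -> D u v -> D w v.
Proof.
move=> uv vw wx xu nwu nxv D_uv; rewrite KT_flip //; apply/negP => D_vw.
have nuv := edge_neq uv; have nvw := edge_neq vw.
have nwx := edge_neq wx; have nxu := edge_neq xu.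
have neqs := (nuv, nvw, nwx, nxu, nwu, nxv).
have flip (a b : V) : a != b -> b != a by rewrite eq_sym.
have neqs' := (flip _ _ nuv, flip _ _ nvw, flip _ _ nwx, flip _ _ nxu,
               flip _ _ nwu, flip _ _ nxv).
case D_wx: (D w x); case D_xu: (D x u).
- by apply: (@KT_acyclic u [:: v; w; x]);
    rewrite /= ?inE ?negb_or ?D_uv ?D_vw ?D_wx ?D_xu ?neqs ?neqs'.
- have D_ux : D u x by rewrite KT_flip ?D_xu.
  by have := @KT_unique_path u [:: v; w; x] [:: x];
    rewrite /= D_uv D_vw D_wx D_ux !inE !negb_or !neqs !neqs'
    => /(_ isT isT isT isT erefl isT).
- have D_xw : D x w by rewrite KT_flip ?D_wx.
  by have := @KT_unique_path x [:: u; v; w] [:: w];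
    rewrite /= D_uv D_vw D_xw D_xu !inE !negb_or !neqs !neqs'
    => /(_ isT isT isT isT erefl isT).
- have D_xw : D x w by rewrite KT_flip ?D_wx.
  have D_ux : D u x by rewrite KT_flip ?D_xu.
  suff [vx] : [:: v; w] = [:: x; w] by rewrite vx eqxx in nxv.
  by apply: (@KT_unique_path u);
    rewrite /= ?D_uv ?D_vw ?D_xw ?D_ux ?inE ?negb_or ?neqs ?neqs'.
Qed.

(** Restricting to square edges makes this usable as a colouring: the other edges at [v] may point
    either way. *)
Definition source v := [exists w, square_edge v w && D v w].

(* Two squares through a vertex of degree at most 3 share an edge at that
   vertex, so a vertex is a source of all its squares or a sink of all of them. *)
Lemma KT_square_proper : max_degree e <= 3 -> square_proper source.
Proof.
move=> deg u v; wlog D_uv : u v / D u v.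
  move=> H uv; have /square_edgeP[w [x [_ _ e_uv _]]] := uv.
  case D_uv: (D u v); first exact: H.
  by rewrite eq_sym; apply: H; [rewrite KT_flip ?D_uv | rewrite square_edge_sym].
move=> uv.
have -> : source u by apply/existsP; exists v; rewrite uv.
rewrite eq_sym; apply/negP => /eqP/existsP[w /andP[vw D_vw]].
case/square_edgeP: uv => a [x [nau nxv e_uv [va ax xu]]].
have D_av := KT_square_alternates e_uv va ax xu nau nxv D_uv.
have vw' := vw; rewrite square_edge_sym in vw'.
case/square_edgeP: vw' => b [y [nbw nyv e_wv [vb e_by yw]]].
(* If [b] pointed to [v], alternation on the square through [b], [v], [w] would make [w] point to
   [v]. *)
have D_vb : D v b.
  rewrite KT_flip 1?sym_e //; apply/negP => D_bv.
  have := @KT_square_alternates b v w y; rewrite D_bv sym_e vb sym_e e_wv sym_e yw.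
  rewrite sym_e e_by eq_sym nbw nyv => /(_ isT isT isT isT isT isT isT).
  by rewrite KT_flip ?D_vw // sym_e.
have in_out p q : D p v -> D v q -> p != q.
  by move=> pv; apply: contraTneq => <-; rewrite (KT_flip (KT_edge pv)) pv.
(* The in-neighbours [u], [a] and the out-neighbours [w], [b] are four distinct neighbours of
   [v]. *)
suff : size [:: u; a; w; b] <= 3 by [].
apply: (@max_degree3_neighbours v) => //=.
  by rewrite !inE !negb_or (eq_sym u a) (eq_sym w b) nau nbw
    (in_out u w) ?(in_out u b) ?(in_out a w) ?(in_out a b).
by apply/and5P; rewrite -!(sym_e v) in e_uv e_wv *; split.
Qed.

End Necessity.

(** * Sufficiency: a happy colouring gives a KT orientation *)

Section Sufficiency.
Variables (c : V -> bool) (r : V -> nat).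
Hypotheses (tf : ~~ triangle) (sq_c : square_proper c).
Hypotheses (happy : forall v, ~~ unhappy c v) (inj_r : injective r).
Notation D := (orient c r).

(** This is the form in which it is used that monochromatic edges form a matching. *)
Lemma happy_mate v w1 w2 : e v w1 -> e v w2 -> c v = c w1 -> c v = c w2 -> w1 = w2.
Proof.
move=> e1 e2 c1 c2; apply/eqP; apply: contraNT (happy v) => nw.
apply/existsP; exists w1; apply/existsP; exists w2.
by rewrite nw e1 e2 -c1 -c2 eqxx.
Qed.

Lemma orient_orientation : orientation e D.
Proof.
split=> [u v /andP[] // | u v uv]; rewrite /orient uv sym_e uv /= (eq_sym (c v)).
case: eqVneq => [_|]; last by case: (c u); case: (c v).
have : r u != r v by apply: contra_neq (edge_neq uv); apply: inj_r.
by case: ltngtP.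
Qed.

(* Along a path the colour changes at most once, from [true] to [false], and no
   two consecutive edges are monochromatic. *)
Variant short_path u : seq V -> Prop :=
  | PathNil : short_path u [::]
  | PathMono v of D u v & c u = c v : short_path u [:: v]
  | PathCross v of D u v & c u & ~~ c v : short_path u [:: v]
  | PathMonoCross a v of D u a & D a v & c u & c a & ~~ c v :
      short_path u [:: a; v]
  | PathCrossMono b v of D u b & D b v & c u & ~~ c b & ~~ c v :
      short_path u [:: b; v]
  | PathMonoCrossMono a b v of D u a & D a b & D b v & c u & c a & ~~ c b & ~~ c v :
      short_path u [:: a; b; v].

Lemma orient_step u v : D u v -> e u v /\ (c u = c v /\ r u < r v \/ c u /\ ~~ c v).
Proof.
case/andP=> ->; case: eqP => [-> ? | ]; first by split=> //; left.
by move=> + cu; rewrite cu; case: (c v) => // _; split=> //; right.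
Qed.

Lemma orient_le u v : D u v -> c v -> c u.
Proof. by move/orient_step => [_ [[-> _]|[-> _]]]. Qed.

(** The matching would force [u = w], while [r] increases strictly along monochromatic arcs. *)
Lemma orient_mono2 u v w : D u v -> D v w -> ~~ ((c u == c v) && (c v == c w)).
Proof.
move=> Duv Dvw; apply/negP => /andP[/eqP cuv /eqP cvw].
have [uv [[_ ruv]|[]]] := orient_step Duv; last by rewrite cuv => ->.
have [vw [[_ rvw]|[]]] := orient_step Dvw; last by rewrite cvw => ->.
have uw : u = w by apply: (@happy_mate v); rewrite // sym_e.
by move: rvw; rewrite -uw ltnNge ltnW.
Qed.

Lemma orient_path u p : path D u p -> short_path u p.
Proof.
case: p => [|v [|w [|x p]]] /=; first by constructor.
- rewrite andbT => Duv; have := orient_le Duv.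
  case cu: (c u); case cv: (c v) => //= H; try by have := H isT.
  + by apply: PathMono; rewrite // cu.
  + by apply: PathCross; rewrite ?cu ?cv.
  + by apply: PathMono; rewrite // cu.
- rewrite andbT => /andP[Duv Dvw].
  have := orient_le Duv; have := orient_le Dvw; have := orient_mono2 Duv Dvw.
  case cu: (c u); case cv: (c v); case cw: (c w) => //= _ H1 H2;
    try by [have := H1 isT | have := H2 isT].
  + by apply: PathMonoCross; rewrite ?cu ?cv ?cw.
  + by apply: PathCrossMono; rewrite ?cu ?cv ?cw.
case/and4P => Duv Dvw Dwx; case: p => [_ | y p /= /andP[Dxy _]].
- have := orient_le Duv; have := orient_le Dvw; have := orient_le Dwx.
  have := orient_mono2 Duv Dvw; have := orient_mono2 Dvw Dwx.
  case cu: (c u); case cv: (c v); case cw: (c w); case cx: (c x) => //= _ _ H1 H2 H3;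
    try by [have := H1 isT | have := H2 isT | have := H3 isT].
  by apply: PathMonoCrossMono; rewrite ?cu ?cv ?cw ?cx.
(* Four arcs with at most one colour change include two consecutive monochromatic ones, so no path
   has more than three. *)
- have := orient_le Duv; have := orient_le Dvw; have := orient_le Dwx.
  have := orient_le Dxy; have := orient_mono2 Duv Dvw.
  have := orient_mono2 Dvw Dwx; have := orient_mono2 Dwx Dxy.
  case cu: (c u); case cv: (c v); case cw: (c w); case cx: (c x); case cy: (c y)
    => //= _ _ _ H1 H2 H3 H4;
    by [have := H1 isT | have := H2 isT | have := H3 isT | have := H4 isT].
Qed.

Lemma orient_unique_path u v p q : u != v -> path D u p -> path D u q ->
  last u p = v -> last u q = v -> p = q.
Proof.
move=> nuv.
have edge a b : D a b -> e a b by case/andP.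
have edgeC a b : D a b -> e b a by rewrite sym_e; apply: edge.
have notri a b d : D a b -> D b d -> D a d -> False.
  by move=> /edge ab /edge bd /edgeC; apply/negP; apply: triangle_free ab bd.
have mate a b d : D a b -> D a d -> c a -> c b -> c d -> b = d.
  by move=> /edge ab /edge ad ca cb cd; apply: (@happy_mate a); rewrite // ca ?cb ?cd.
have mate' a b d : D b a -> D d a -> ~~ c a -> ~~ c b -> ~~ c d -> b = d.
  move=> /edgeC ab /edgeC ad /negbTE ca /negbTE cb /negbTE cd.
  by apply: (@happy_mate a); rewrite // ca ?cb ?cd.
have nosq a b d f : e a b -> e b d -> e d f -> e f a -> c a = c b ->
    d != a -> f != b -> False.
  move=> ab bd df fa cab da fb.
  by have := sq_c (square_edgeI ab bd df fa da fb); rewrite cab eqxx.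
have neq a b : c a -> ~~ c b -> b != a by move=> ca; apply: contraNneq => ->.
(* The names spell the monochromatic ([M]) and crossing ([C]) arcs of the two paths compared. In
   these four cases they either form a 4-cycle with a monochromatic edge, or share their
   monochromatic edge at one end and leave a triangle. *)
have C_MCM a b : D u v -> D u a -> D a b -> D b v ->
    c u -> c a -> ~~ c b -> ~~ c v -> False.
  move=> /edgeC vu /edge ua /edge ab /edge bv cu ca cb cv.
  by apply: (nosq u a b v) => //; rewrite ?cu ?ca // neq.
have MC_CM a b : D u a -> D a v -> D u b -> D b v ->
    c u -> c a -> ~~ c b -> ~~ c v -> False.
  move=> /edge ua /edge av /edgeC bu /edgeC vb cu ca cb cv.
  by apply: (nosq u a v b) => //; rewrite ?cu ?ca // neq.
have MC_MCM a a' b : D u a -> D a v -> D u a' -> D a' b -> D b v ->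
    c u -> c a -> c a' -> False.
  move=> ua av ua' a'b bv cu ca ca'.
  by have aa' := mate _ _ _ ua ua' cu ca ca'; apply: (notri a b v); rewrite // aa'.
have CM_MCM a b b' : D u b -> D b v -> D u a -> D a b' -> D b' v ->
    ~~ c v -> ~~ c b -> ~~ c b' -> False.
  move=> ub bv ua ab' b'v cv cb cb'.
  by have bb' := mate' _ _ _ bv b'v cv cb cb'; apply: (notri u a b); rewrite // bb'.
move=> /orient_path Pp /orient_path Pq lp lq.
case: Pp lp => [|x Dx cx|x Dx cx cx'|a x D1 D2 c1 c2 c3|b x D1 D2 c1 c2 c3
  |a b x D1 D2 D3 c1 c2 c3 c4] /= lp; rewrite ?lp ?eqxx // in nuv *; subst x;
case: Pq lq => [|x Ex ex|x Ex ex ex'|a' x E1 E2 e1 e2 e3|b' x E1 E2 e1 e2 e3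
  |a' b' x E1 E2 E3 e1 e2 e3 e4] /= lq; rewrite ?lq ?eqxx // in nuv *; subst x => //.
(* Different shapes are refuted by the facts above, by [notri] or by the colours of the ends. What
   remains are equal shapes, whose inner vertices the matching identifies. *)
all: try by [exfalso; eauto 3 | rewrite -cx e1 in e3 | rewrite -cx e1 in e4
  | rewrite -ex c1 in c3 | rewrite -ex c1 in c4].
- by rewrite (mate _ _ _ D1 E1).
- by rewrite (mate' _ _ _ D2 E2).
- by rewrite (mate _ _ _ D1 E1) // (mate' _ _ _ D3 E3).
Qed.

Lemma orient_path_mono u p : path D u p ->
  c u = c (last u p) /\ r u <= r (last u p) \/ c u /\ ~~ c (last u p).
Proof.
elim: p u => [|v p IHp] u /=; first by left.
case/andP=> /orient_step[_ [[cuv ruv]|[cu cv]]] /IHp[[cl rl]|[cv' cl]].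
- by left; rewrite cuv (leq_trans (ltnW ruv)).
- by right; rewrite cuv.
- by right; rewrite -cl.
- by right.
Qed.

(** Along a path the colour can only drop from [true] to [false], and [r] does not decrease while
    the colour stays, so no path leads back. *)
Lemma orient_acyclic u v p q : path D u p -> last u p = v ->
  path D v q -> last v q = u -> u = v.
Proof.
move=> /orient_path_mono + lp /orient_path_mono; rewrite lp => + + lq; rewrite lq.
case=> [[-> ruv] | [cu cv]]; case=> [[cc rvu] | [cv' cu']].
- by apply: inj_r; apply/eqP; rewrite eqn_leq ruv.
- by rewrite cv' in cu'.
- by rewrite cc cu in cv.
- by rewrite cv' in cv.
Qed.

Lemma orient_KT : KT_orientation e D.
Proof.
split; first exact: orient_orientation.
have dipathP a b s : dipath D a b s ->
    exists p, [/\ s = a :: p, path D a p & last a p = b].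
  by case: s => // x p /and4P[/= /eqP[->] /eqP lp Dp _]; exists p.
move=> u v s1 s2 nuv.
(* Paths in the same direction coincide by uniqueness; opposite directions contradict acyclicity. *)
case/orP => /dipathP[p [-> Dp lp]]; case/orP => /dipathP[q [-> Dq lq]].
- by rewrite (orient_unique_path nuv Dp Dq).
- by rewrite (orient_acyclic Dp lp Dq lq) eqxx in nuv.
- by rewrite (orient_acyclic Dq lq Dp lp) eqxx in nuv.
- by rewrite eq_sym in nuv; rewrite (orient_unique_path nuv Dp Dq).
Qed.

End Sufficiency.

End Squares.

(** * Local search on the number of monochromatic edges *)

Definition flip (V : eqType) (c : V -> bool) v w := c w (+) (w == v).

Section LocalSearch.
Variables (V : finType) (e : rel V).
Hypotheses (sym_e : symmetric e) (irr_e : irreflexive e).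
Hypothesis deg_e : max_degree e <= 3.
Implicit Types c : V -> bool.

(** The sum is over ordered pairs, so for symmetric [e] a monochromatic edge counts twice. *)
Definition mono c := \sum_u \sum_w (e u w && (c u == c w)).

Lemma mono_split c v : mono c =
  2 * (\sum_w (e v w && (c v == c w))) +
  \sum_(u | u != v) \sum_(w | w != v) (e u w && (c u == c w)).
Proof.
rewrite /mono (bigD1 v) //= mul2n -addnn -addnA; congr addn.
rewrite [in RHS](bigD1 v) //= irr_e add0n -big_split /=.
by apply: eq_bigr => u nuv; rewrite (bigD1 v) //= sym_e eq_sym.
Qed.

Lemma mono_flip c v : unhappy e c v -> mono (flip c v) < mono c.
Proof.
case/existsP=> w1 /existsP[w2 /and5P[nw e1 e2 c1 c2]].
rewrite !(mono_split _ v) -addSn.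
rewrite [X in _ <= _ + X](_ : _ =
    \sum_(u | u != v) \sum_(w | w != v) (e u w && (flip c v u == flip c v w))).
  rewrite leq_add2r ltn_mul2l /=.
  (* Flipping [v] exchanges the monochromatic and the bichromatic edges at [v], so the two counts
     add up to its degree. With two or more before the flip, at most one is left after it. *)
  have deg : \sum_w (e v w && (flip c v v == flip c v w)) +
             \sum_w (e v w && (c v == c w)) <= 3.
    rewrite -big_split /=; apply: leq_trans deg_e.
    apply: leq_trans (leq_bigmax v); rewrite -sum1_card [leqRHS]big_mkcond /=.
    apply: leq_sum => w _; rewrite -[w \in _]/(e v w) /flip eqxx.
    case: (boolP (e v w)) => // /(edge_neq irr_e); rewrite eq_sym => /negbTE ->.
    by case: (c v); case: (c w).
  suff : 2 <= \sum_w (e v w && (c v == c w)) by move: deg; lia.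
  have nw' : w2 != w1 by rewrite eq_sym.
  rewrite (bigD1 w1) //= (bigD1 w2) //=.
  by rewrite e1 e2 c1 c2.
apply: eq_bigr => u /negbTE nu; apply: eq_bigr => w /negbTE nw'.
by rewrite /flip nu nw' !addbF.
Qed.

(* An endpoint of a square edge lies on two edges whose other ends have the
   opposite colour, which leaves room for a single neighbour of its own colour. *)
Lemma unhappy_not_square c v w :
  square_proper e c -> unhappy e c v -> ~~ square_edge e v w.
Proof.
move=> sq_c /existsP[w1 /existsP[w2 /and5P[nw e1 e2 /eqP c1 /eqP c2]]].
apply/negP => vw; have /square_edgeP[a [b [nav nbw e_vw [wa ab bv]]]] := vw.
have vb : square_edge e v b.
  by apply: (@square_edgeI _ _ v b a w); rewrite // 1?sym_e // eq_sym.
have opp x y : square_edge e v x -> c v = c y -> x != y.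
  by move=> /sq_c + vy; rewrite vy; apply: contra_neq => ->.
suff : size [:: b; w; w1; w2] <= 3 by [].
apply: (max_degree3_neighbours (v := v) deg_e) => /=.
  by rewrite !inE !negb_or nbw nw !opp.
by rewrite (sym_e v b) bv e_vw e1 e2.
Qed.

(** An unhappy vertex lies on no square edge, so the flip is invisible to all of them. *)
Lemma square_proper_flip c v :
  square_proper e c -> unhappy e c v -> square_proper e (flip c v).
Proof.
move=> sq_c uv x y xy; rewrite /flip.
have nv : forall z t, square_edge e z t -> (z == v) = false.
  by move=> z t; apply: contraTF => /eqP->; apply: unhappy_not_square sq_c uv.
have yx := xy; rewrite square_edge_sym // in yx.
by rewrite (nv _ _ xy) (nv _ _ yx) !addbF sq_c.
Qed.

Lemma mono_le c : mono c <= #|V| * #|V|.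
Proof.
rewrite /mono -[X in _ <= X * _]sum1_card big_distrl /=; apply: leq_sum => u _.
by rewrite mul1n -sum1_card; apply: leq_sum => w _; case: (_ && _).
Qed.

End LocalSearch.

(** * Merging classes of vertices with known relative colours *)

Section Merge.
Variables (V : Type) (lab : V -> nat) (col : V -> bool).

(** Within each class of [l], [d] agrees with [c] up to exchanging the two colours. *)
Definition coherent (c : V -> bool) (l : V -> nat) (d : V -> bool) :=
  forall w w', l w = l w' -> d w (+) d w' = c w (+) c w'.

Definition merge_label u v w := if lab w == lab v then lab u else lab w.
(** The class of [v] is recoloured as a whole if [u] and [v] agree, which makes these two opposite
    when distinct classes are joined. *)
Definition merge_colour u v w :=
  col w (+) ((lab w == lab v) && (col u == col v)).

(** The colouring [c] is unknown to the algorithm, but that it separates [u] and [v] determines how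
    their classes fit together: vertices of the two classes are compared through [u] and [v]. *)
Lemma merge_coherent c u v : c u != c v -> coherent c lab col ->
  coherent c (merge_label u v) (merge_colour u v).
Proof.
move=> cuv coh w w'; rewrite /merge_label /merge_colour.
case: (eqVneq (lab w) (lab v)) => lw; case: (eqVneq (lab w') (lab v)) => lw' ll /=.
- have := coh w w'; rewrite lw lw' => /(_ erefl) <-.
  by case: (col w); case: (col w'); case: (_ == _).
- have := coh w v lw; have := coh u w' ll; move: cuv.
  by case: (c u); case: (c v); case: (c w); case: (c w'); case: (col u);
     case: (col v); case: (col w); case: (col w').
- have := coh w u ll; have := coh w' v lw'; move: cuv.
  by case: (c u); case: (c v); case: (c w); case: (c w'); case: (col u);
     case: (col v); case: (col w); case: (col w').
- by rewrite !addbF; apply: coh.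
Qed.

End Merge.

(** * The algorithm *)

Section Algorithm.
Implicit Types (M : seq (seq bool)) (col : seq bool) (u v w x : nat).

Definition vertices M := iota 0 (size M).
Definition adj M u v := nth false (nth [::] M u) v.
Definition pairs M := flatten [seq [seq (u, v) | v <- vertices M] | u <- vertices M].

Definition has_triangle M :=
  has (fun u => has (fun v => has (fun w =>
    [&& adj M u v, adj M v w & adj M w u]) (vertices M)) (vertices M)) (vertices M).

Definition in_square M u v :=
  adj M u v && has (fun w => has (fun x =>
    [&& w != u, x != v, adj M v w, adj M w x & adj M x u])
    (vertices M)) (vertices M).

Definition merge_classes M (uv : nat * nat) (st : seq nat * seq bool) :=
  if in_square M uv.1 uv.2 then
    ([seq merge_label (nth 0 st.1) uv.1 uv.2 w | w <- vertices M],
     [seq merge_colour (nth 0 st.1) (nth false st.2) uv.1 uv.2 w | w <- vertices M])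
  else st.

Definition components M :=
  foldr (merge_classes M) (vertices M, [seq false | _ <- vertices M]) (pairs M).

(** Merging returns a colouring in every case; this check tells whether it is proper on square
    edges. *)
Definition improper M col :=
  has (fun u => has (fun v => in_square M u v && (nth false col u == nth false col v))
    (vertices M)) (vertices M).

Definition unhappy_at M col v :=
  has (fun w1 => has (fun w2 =>
    [&& w1 != w2, adj M v w1, adj M v w2, nth false col v == nth false col w1
      & nth false col v == nth false col w2]) (vertices M)) (vertices M).

(** Without unhappy vertices [find] returns [size M], which is no vertex, and nothing is flipped. *)
Definition improve M col :=
  [seq flip (nth false col) (find (unhappy_at M col) (vertices M)) w | w <- vertices M].

(** The list [pairs M] is only a counter: its length is the bound on [mono], hence on the number of
    flips. *)
Definition settle M := foldr (fun _ => improve M) (components M).2 (pairs M).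

Definition orient_matrix M col :=
  [seq [seq adj M u v && (if nth false col u == nth false col v then u < v
                          else nth false col u)
    | v <- vertices M] | u <- vertices M].

Definition solve M :=
  if has_triangle M || improper M (components M).2 then None
  else Some (orient_matrix M (settle M)).

End Algorithm.

(** * Running time of the algorithm *)

Lemma polytime_vertices A {eA : encodable A} (M : A -> seq (seq bool)) :
  polytime M -> polytime (fun a => vertices (M a)).
Proof. by move=> pM; apply/polytime_iota/polytime_size. Qed.

Lemma polytime_adj A {eA : encodable A} (M : A -> seq (seq bool)) (u v : A -> nat) :
  polytime M -> polytime u -> polytime v ->
  polytime (fun a => adj (M a) (u a) (v a)).
Proof. by move=> pM pu pv; apply: polytime_nth => //; apply: polytime_nth. Qed.

(* Syntactic dispatch: plain backtracking over the closure lemmas would let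
   unification unfold the goal. *)
Ltac polytime_step := lazymatch goal with
  | |- polytime (fun a => a) => exact: polytime_id
  | |- polytime fst => exact: (polytime_fst polytime_id)
  | |- polytime snd => exact: (polytime_snd polytime_id)
  | |- polytime (fun a => (@?f a).1) => apply: (polytime_fst (f := f))
  | |- polytime (fun a => (@?f a).2) => apply: (polytime_snd (f := f))
  | |- polytime (fun a => (@?f a, @?g a)) => apply: (polytime_pair (f := f) (g := g))
  | |- polytime (fun a => Some (@?f a)) => apply: (polytime_Some (f := f))
  | |- polytime (fun a => @?f a && @?g a) => apply: (polytime_andb (b1 := f) (b2 := g))
  | |- polytime (fun a => @?f a || @?g a) => apply: (polytime_orb (b1 := f) (b2 := g))
  | |- polytime (fun a => @?f a (+) @?g a) => apply: (polytime_addb (b1 := f) (b2 := g))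
  | |- polytime (fun a => ~~ @?f a) => apply: (polytime_negb (b := f))
  | |- polytime (fun a => @?f a == @?g a) =>
      first [ apply: (polytime_eqb (b1 := f) (b2 := g))
            | apply: (polytime_eqn (m := f) (n := g)) ]
  | |- polytime (fun a => @?f a <= @?g a) => apply: (polytime_leq (m := f) (n := g))
  | |- polytime (fun a => (@?f a).+1) => apply: (polytime_succn (n := f))
  | |- polytime (fun a => nth _ (@?s a) (@?i a)) =>
      apply: (polytime_nth (l := s) (i := i) erefl)
  | |- polytime (fun a => has (@?P a) (@?s a)) => apply: (polytime_has (P := P) (l := s))
  | |- polytime (fun a => find (@?P a) (@?s a)) =>
      apply: (polytime_find (P := P) (l := s))
  | |- polytime (fun a => map (@?f a) (@?s a)) => apply: (polytime_map (f := f) (l := s))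
  | |- polytime (fun a => flatten (@?s a)) => apply: (polytime_flatten (l := s))
  | |- polytime (fun a => vertices (@?M a)) => apply: (polytime_vertices (M := M))
  | |- polytime (fun a => adj (@?M a) (@?u a) (@?v a)) =>
      apply: (polytime_adj (M := M) (u := u) (v := v))
  | |- polytime (fun _ => ?b) => exact: polytime_const
  | |- _ => first [assumption | apply: polytime_if]
  end.
Ltac polytime := repeat (polytime_step; cbn beta).

Lemma polytime_in_square A {eA : encodable A} (M : A -> seq (seq bool))
    (u v : A -> nat) :
  polytime M -> polytime u -> polytime v ->
  polytime (fun a => in_square (M a) (u a) (v a)).
Proof.
move=> pM pu pv.
have p : polytime (fun p : seq (seq bool) * nat * nat => in_square p.1.1 p.1.2 p.2).
  by rewrite /in_square; polytime.
apply: (polytime_comp (f := fun a => (M a, u a, v a)) _ p).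
by do 2 apply: polytime_pair => //.
Qed.

Lemma polytime_has_triangle : polytime has_triangle.
Proof. by rewrite /has_triangle; polytime. Qed.

Lemma polytime_pairs : polytime pairs.
Proof. by rewrite /pairs; polytime. Qed.

Lemma polytime_improper :
  polytime (fun p : seq (seq bool) * seq bool => improper p.1 p.2).
Proof.
rewrite /improper; polytime; apply: polytime_in_square; polytime.
Qed.

Lemma polytime_improve :
  polytime (fun p : seq (seq bool) * seq bool => improve p.1 p.2).
Proof. by rewrite /improve /unhappy_at /flip; polytime. Qed.

Lemma polytime_orient_matrix :
  polytime (fun p : seq (seq bool) * seq bool => orient_matrix p.1 p.2).
Proof. by rewrite /orient_matrix; polytime. Qed.

Lemma polytime_merge : polytime
  (fun p : seq (seq bool) * (nat * nat) * (seq nat * seq bool) =>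
    merge_classes p.1.1 p.1.2 p.2).
Proof.
rewrite /merge_classes /merge_label /merge_colour.
apply: polytime_if; first (apply: polytime_in_square; polytime).
  by polytime.
by polytime.
Qed.

Lemma pbounded_size : pbounded (fun M : seq (seq bool) => size M).
Proof. by apply: pbounded_le pbounded_esize => M; apply/ltnW/size_esize. Qed.

Lemma esize_bitseq (s : seq bool) : esize s <= (size s * 4).+1.
Proof. by apply: esize_all; apply/allP => b _; apply: esize_bool. Qed.

Lemma size_vertices M : size (vertices M) = size M.
Proof. exact: size_iota. Qed.

(** This gives the size bound for the fold: merging only copies labels, so they never exceed
    [size M]. *)
Lemma foldr_merge_size M s :
  let st := foldr (merge_classes M) (vertices M, [seq false | _ <- vertices M]) s in
  [/\ size st.1 = size M, all (fun x => x <= size M) st.1 & size st.2 = size M].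
Proof.
elim: s => [|uv s] /=.
  split; rewrite ?size_map ?size_vertices //.
  by apply/allP => x; rewrite mem_iota => /andP[_ /ltnW].
rewrite /merge_classes; case: in_square => //=.
set st := foldr _ _ _; case=> _ /allP le_lab _.
split; rewrite ?size_map ?size_vertices // all_map.
have le_nth x : nth 0 st.1 x <= size M.
  have [lt_x|ge_x] := ltnP x (size st.1); first exact/le_lab/mem_nth.
  by rewrite nth_default.
by apply/allP => w _ /=; rewrite /merge_label; case: ifP.
Qed.

Lemma polytime_components : polytime components.
Proof.
apply: (polytime_foldr (f := merge_classes)
  (z := fun M => (vertices M, [seq false | _ <- vertices M]))
  (G := fun M => size M * (2 * size M + 2) + size M * 4 + 3)) => //.
- exact: polytime_merge.
- by polytime.
- exact: polytime_pairs.
- by have b := pbounded_size; pbounded.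
move=> M _ s _; have := foldr_merge_size M s; set st := foldr _ _ _.
case: st => lab col /= [size_lab le_lab size_col].
have := @esize_all _ _ (2 * size M).+1 lab.
have := esize_bitseq col.
rewrite esize_pair size_lab size_col => ec el.
have {}el : esize lab <= (size M * (2 * size M).+2).+1.
  by apply: el; apply: sub_all le_lab => x; rewrite esize_nat ltnS leq_mul2l.
move: el ec; lia.
Qed.

Lemma polytime_settle : polytime settle.
Proof.
apply: (polytime_foldr (f := fun M _ => improve M) (z := fun M => (components M).2)
  (G := fun M => size M * 4 + 1)).
- apply: (polytime_comp (f := fun p => (p.1.1, p.2)) _ polytime_improve).
  by polytime.
- exact/polytime_snd/polytime_components.
- exact: polytime_pairs.
- by have b := pbounded_size; pbounded.
move=> M _ s _; rewrite addn1; apply: leq_trans (esize_bitseq _) _.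
rewrite ltnS leq_mul2r; case: s => [|uv s] /=.
  by have [_ _ ->] := foldr_merge_size M (pairs M).
by rewrite size_map size_vertices leqnn.
Qed.

Lemma polytime_solve : polytime solve.
Proof.
apply: polytime_if; [apply: polytime_orb | exact: polytime_const | apply: polytime_Some].
- exact: polytime_has_triangle.
- apply: (polytime_comp (f := fun M => (M, (components M).2)) _ polytime_improper).
  by apply: polytime_pair; [apply: polytime_id | apply/polytime_snd/polytime_components].
apply: (polytime_comp (f := fun M => (M, settle M)) _ polytime_orient_matrix).
by apply: polytime_pair; [apply: polytime_id | apply: polytime_settle].
Qed.

Lemma polytime_runs A B {eA : encodable A} {eB : encodable B} (f : A -> B) :
  polytime f -> exists c k, forall a, exists t,
    runs c (enc a) t (enc (f a)) /\ t <= k * tree_size (enc a) ^ k + k.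
Proof.
(* For input size [N], the bound [N.+1 ^ k] is at most [2 ^ k * N ^ k]; one number has to serve as
   both coefficient and exponent. *)
case=> _ [T [k hk] /(_ 0)[c run_c]]; exists c, (2 ^ k + k) => a.
have [t [s [ex s0 _ le_t]]] := run_c (init_store (enc a)) a erefl.
exists t; split; first by exists s.
apply: leq_trans le_t _; apply: leq_trans (hk a) _; apply: leq_trans (leq_addr _ _).
have le_N : (esize a).+1 <= 2 * esize a by have := @esize_gt0 _ eA a; lia.
apply: leq_trans (leq_exp k le_N) _; rewrite expnMn leq_mul ?leq_addr //.
by rewrite leq_pexp2l ?leq_addl // esize_gt0.
Qed.

(** * Correctness on adjacency matrices *)

Section Correctness.
Variables (n : nat) (e : rel 'I_n).
Hypotheses (sym_e : symmetric e) (irr_e : irreflexive e).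
Hypothesis deg_e : max_degree e <= 3.

Definition adjacency_matrix (r : rel 'I_n) :=
  [seq [seq r u v | v <- enum 'I_n] | u <- enum 'I_n].

Notation M := (adjacency_matrix e).
Notation colour col := (fun u : 'I_n => nth false col u).

Lemma vertices_matrix : vertices M = iota 0 n.
Proof. by rewrite /vertices size_map size_enum_ord. Qed.

Lemma adj_matrix (u v : 'I_n) : adj M u v = e u v.
Proof.
rewrite /adj (nth_map u) ?size_enum_ord // (nth_map v) ?size_enum_ord //.
by rewrite !nth_ord_enum.
Qed.

Lemma has_vertices P : has P (vertices M) = [exists u : 'I_n, P u].
Proof.
rewrite vertices_matrix -val_enum_ord has_map.
apply/hasP/existsP => [[u _ Pu] | [u Pu]]; exists u => //.
exact: mem_enum.
Qed.

Lemma nth_vertices T (x0 : T) f (u : 'I_n) :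
  nth x0 [seq f w | w <- vertices M] u = f u.
Proof. by rewrite vertices_matrix (nth_map 0) ?size_iota // nth_iota. Qed.

Lemma has_triangle_matrix : has_triangle M = triangle e.
Proof.
rewrite /has_triangle has_vertices; apply: eq_existsb => u.
rewrite has_vertices; apply: eq_existsb => v.
by rewrite has_vertices; apply: eq_existsb => w; rewrite !adj_matrix.
Qed.

Lemma in_square_matrix (u v : 'I_n) : in_square M u v = square_edge e u v.
Proof.
rewrite /in_square /square_edge adj_matrix; congr andb.
rewrite has_vertices; apply: eq_existsb => w.
by rewrite has_vertices; apply: eq_existsb => x; rewrite !adj_matrix.
Qed.

Lemma unhappy_matrix col (v : 'I_n) : unhappy_at M col v = unhappy e (colour col) v.
Proof.
rewrite /unhappy_at has_vertices; apply: eq_existsb => w1.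
by rewrite has_vertices; apply: eq_existsb => w2; rewrite !adj_matrix.
Qed.

Lemma improper_matrix col : reflect (square_proper e (colour col)) (~~ improper M col).
Proof.
rewrite /improper has_vertices; apply: (iffP existsPn) => [H u v uv | sq_c u].
  by move: (H u); rewrite has_vertices => /existsPn/(_ v); rewrite in_square_matrix uv.
rewrite has_vertices; apply/existsPn => v; rewrite in_square_matrix.
by apply/negP => /andP[/sq_c/negbTE->].
Qed.

Lemma pairs_matrix (u v : 'I_n) : (val u, val v) \in pairs M.
Proof.
by apply: allpairs_f; rewrite vertices_matrix mem_iota /=.
Qed.

Lemma size_pairs_matrix : size (pairs M) = n * n.
Proof. by rewrite (size_allpairs pair) vertices_matrix size_iota. Qed.

(** Two invariants of the merging: the classes stay coherent with any proper [c], and every square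
    edge already treated lies inside a class. *)
Lemma foldr_merge_coherent c s : square_proper e c ->
  {in s, forall p, p.1 < n /\ p.2 < n} ->
  let st := foldr (merge_classes M) (vertices M, [seq false | _ <- vertices M]) s in
  coherent c (fun w : 'I_n => nth 0 st.1 w) (colour st.2) /\
  forall u v : 'I_n, (val u, val v) \in s -> square_edge e u v ->
    nth 0 st.1 u = nth 0 st.1 v.
Proof.
move=> sq_c; elim: s => [|[u v] s IHs] /= lt_s.
  split=> // w w' /=; rewrite vertices_matrix !nth_iota // => /val_inj ->.
  by rewrite !addbb.
have [lt_u lt_v] := lt_s _ (mem_head _ _); rewrite /= in lt_u lt_v.
case: IHs => [p ps|]; first by apply: lt_s; rewrite inE ps orbT.
set st := foldr _ _ _ => coh same.
pose u' := Ordinal lt_u; pose v' := Ordinal lt_v.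
have hd x y : (val x, val y) == (u, v) -> x = u' /\ y = v'.
  by move=> /eqP[xu yv]; split; apply: val_inj.
rewrite /merge_classes /= -[u in in_square _ u]/(val u').
rewrite -[v in in_square _ _ v]/(val v') in_square_matrix.
case: ifP => uv /=; last first.
  split=> // x y; rewrite inE => /orP[/hd[-> ->]|]; last exact: same.
  by rewrite uv.
split=> [w w' | x y].
  rewrite !nth_vertices.
  exact: (merge_coherent (lab := fun w : 'I_n => nth 0 st.1 w)
           (col := colour st.2) (sq_c _ _ uv) coh).
rewrite !nth_vertices /merge_label inE => /orP[/hd[-> ->] _|xy sxy].
  by rewrite eqxx; case: ifP.
by rewrite (same _ _ xy sxy).
Qed.

(** Finally both ends of each square edge share a class, where coherence with [c] makes their
    colours differ. *)
Lemma components_proper c : square_proper e c ->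
  square_proper e (colour (components M).2).
Proof.
move=> sq_c; have [|coh same] := @foldr_merge_coherent c (pairs M) sq_c.
  by move=> p /allpairsP[q [+ + ->]]; rewrite vertices_matrix !mem_iota.
move=> u v uv; have := coh u v (same u v (pairs_matrix u v) uv).
rewrite -/(components M); move: (sq_c _ _ uv).
by case: (c u); case: (c v); do 2 case: (nth _ _ _).
Qed.

Lemma eq_mono (c d : 'I_n -> bool) : c =1 d -> mono e c = mono e d.
Proof. by move=> cd; apply: eq_bigr => u _; apply: eq_bigr => v _; rewrite !cd. Qed.

Lemma eq_unhappy (c d : 'I_n -> bool) : c =1 d -> unhappy e c =1 unhappy e d.
Proof.
by move=> cd v; apply: eq_existsb => w1; apply: eq_existsb => w2; rewrite !cd.
Qed.

(** The vertex flipped is the first unhappy one, not necessarily [v]. *)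
Lemma improve_flip col (v : 'I_n) : unhappy e (colour col) v ->
  exists2 w : 'I_n, unhappy e (colour col) w
    & colour (improve M col) =1 flip (colour col) w.
Proof.
move=> uv; have hasu : has (unhappy_at M col) (vertices M).
  by rewrite has_vertices; apply/existsP; exists v; rewrite unhappy_matrix.
have := hasu; rewrite has_find {2}vertices_matrix size_iota => lt_f.
exists (Ordinal lt_f) => [|u]; last by rewrite nth_vertices.
rewrite -unhappy_matrix /=; have := nth_find 0 hasu.
by rewrite [X in nth _ X]vertices_matrix nth_iota.
Qed.

Lemma improve_happy col : (forall v, ~~ unhappy e (colour col) v) ->
  colour (improve M col) =1 colour col.
Proof.
move=> happy u; rewrite nth_vertices /flip (_ : _ == _ = false) ?addbF //.
apply: ltn_eqF; rewrite hasNfind ?vertices_matrix ?size_iota //.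
rewrite -vertices_matrix has_vertices; apply/existsPn => v.
by rewrite unhappy_matrix.
Qed.

(** A round either finds nothing to flip, and then nothing changes any more, or lowers [mono] by at
    least one. *)
Lemma foldr_improve col (s : seq (nat * nat)) : square_proper e (colour col) ->
  let col' := foldr (fun _ => improve M) col s in
  square_proper e (colour col') /\
  ((forall v, ~~ unhappy e (colour col') v) \/
   mono e (colour col') + size s <= mono e (colour col)).
Proof.
move=> sq_col; elim: s => [|p s [sq_s IHs]] /=; first by rewrite addn0; split; [|right].
set col' := foldr _ _ _ in sq_s IHs *.
have [/existsP[v uv]|/existsPn happy] := boolP [exists v, unhappy e (colour col') v].
  have [w uw impE] := improve_flip uv; split.
    by move=> x y xy; rewrite !impE; apply: square_proper_flip xy.
  right; case: IHs => [/(_ v)|]; first by rewrite uv.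
  apply: leq_trans; rewrite (eq_mono impE) addnS -addSn leq_add2r.
  exact: mono_flip.
have impE := improve_happy happy; split.
  by move=> x y xy; rewrite !impE; apply: sq_s.
by left=> v; rewrite (eq_unhappy impE).
Qed.

(** Initially [mono] is at most [n * n]. If each of the [n * n] rounds lowered it, it is now 0 and
    no unhappy vertex is left to lower it further. *)
Lemma settle_spec : square_proper e (colour (components M).2) ->
  square_proper e (colour (settle M)) /\
  forall v, ~~ unhappy e (colour (settle M)) v.
Proof.
move=> sq_c; have [] := foldr_improve (pairs M) sq_c; rewrite -/(settle M).
move=> sq_s [//|le_m]; split=> // v; apply/negP.
move=> /(mono_flip sym_e irr_e deg_e); rewrite ltnNge => /negP; apply.
have := mono_le e (colour (components M).2).
by move: le_m; rewrite card_ord size_pairs_matrix; lia.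
Qed.

Lemma orient_matrixE col :
  orient_matrix M col = adjacency_matrix (orient e (colour col) val).
Proof.
rewrite /orient_matrix /adjacency_matrix vertices_matrix -val_enum_ord -map_comp.
apply: eq_map => u /=; rewrite -map_comp; apply: eq_map => v /=.
by rewrite adj_matrix.
Qed.

Lemma solve_correct : exists o : option (rel 'I_n),
  enc (solve M) = enc_option (@enc_rel n) o /\ KT_answer e o.
Proof.
rewrite /solve has_triangle_matrix.
have [tri|tf] := boolP (triangle e) => /=.
  exists None; split=> // -[D KT_D].
  by have := KT_triangle_free sym_e irr_e KT_D; rewrite tri.
have [imp|/improper_matrix/settle_spec[sq_s happy]] := boolP (improper M _).
  exists None; split=> // -[D KT_D].
  (* A KT orientation would make [source] proper on square edges, and then merging would have found
     a proper colouring too. *)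
  have := components_proper (KT_square_proper sym_e irr_e KT_D deg_e).
  by move/improper_matrix; rewrite imp.
exists (Some (orient e (colour (settle M)) val)); split.
  by rewrite orient_matrixE.
by apply: orient_KT => //; apply: val_inj.
Qed.

End Correctness.

Theorem theorem6p1 :
  exists (c : cmd) (k : nat),
  forall (n : nat) (e : rel 'I_n),
    simple_graph e ->
    max_degree e <= 3 ->
    exists (t : nat) (o : option (rel 'I_n)),
      [/\ runs c (enc_rel e) t (enc_option (@enc_rel n) o),
          t <= k * tree_size (enc_rel e) ^ k + k
        & KT_answer e o].
Proof.
have [c [k run_c]] := polytime_runs polytime_solve.
exists c, k => n e [sym_e irr_e] deg_e.
have [o [oE KT_o]] := solve_correct sym_e irr_e deg_e.
(* By definition [enc_rel e] is the encoding of this matrix. *)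
have [t [run_t le_t]] := run_c (adjacency_matrix e).
by exists t, o; split=> //; rewrite -oE.
Qed.
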